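(* Let $\mathbf{L}\in Q^2(\mathbb{D}^2)$ and let $F\colon\mathbb{D}^2\to\mathbb{C}$ be analytic. (i) If $F$ has bounded $\mathbf{L}$-index in joint variables, then for every $R\in(0,\beta]^2$ there exist $n_0\in\mathbb{Z}_+$ and $p\ge1$ such that for every $z^0\in\mathbb{D}^2$ there exists $(k_1^0,k_2^0)\in\mathbb{Z}_+^2$ with $k_1^0+k_2^0\le n_0$ and $$\max\Big\{|F^{(k_1^0,k_2^0)}(z)|: z\in\mathbb{D}^2\Big[z^0,\frac{R}{\mathbf{L}(z^0)}\Big]\Big\}\le p\,|F^{(k_1^0,k_2^0)}(z^0)|.$$ (ii) If for every $R\in(0,\beta]^2$ there exist $n_0\in\mathbb{Z}_+$ and $p\ge1$ such that for every $z^0\in\mathbb{D}^2$ there exist $k_1^0\le n_0$ and $k_2^0\le n_0$ with $$\max\Big\{|F^{(k_1^0,0)}(z)|: z\in\mathbb{D}^2\Big[z^0,\frac{R}{\mathbf{L}(z^0)}\Big]\Big\}\le p\,|F^{(k_1^0,0)}(z^0)|,\qquad \max\Big\{|F^{(0,k_2^0)}(z)|: z\in\mathbb{D}^2\Big[z^0,\frac{R}{\mathbf{L}(z^0)}\Big]\Big\}\le p\,|F^{(0,k_2^0)}(z^0)|,$$ then $F$ has bounded $\mathbf{L}$-index in joint variables.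
   Context: $\mathbb{D}^2=\{(z_1,z_2)\in\mathbb{C}^2:|z_1|<1,|z_2|<1\}$, $\mathbb{Z}_+=\{0,1,2,\dots\}$, $\mathbb{R}_+=[0,\infty)$. A constant $\beta>1$ is fixed. $\mathbf{L}(z)=(l_1(z),l_2(z))$, where each $l_j\colon\mathbb{D}^2\to\mathbb{R}_+$ is continuous and satisfies $l_j(z_1,z_2)>\beta/(1-|z_j|)$ for all $(z_1,z_2)\in\mathbb{D}^2$, $j=1,2$. For $z^0\in\mathbb{C}^2$ and $R=(r_1,r_2)\in\mathbb{R}_+^2$: $\mathbb{D}^2[z^0,R]=\{z:|z_j-z_j^0|\le r_j,\ j=1,2\}$ and $\frac{R}{\mathbf{L}(z^0)}=\big(\frac{r_1}{l_1(z^0)},\frac{r_2}{l_2(z^0)}\big)$. $F^{(p,q)}=\frac{\partial^{p+q}F}{\partial z_1^p\partial z_2^q}$. An analytic $F\colon\mathbb{D}^2\to\mathbb{C}$ has bounded $\mathbf{L}$-index in joint variables if there is $n_0\in\mathbb{Z}_+$ such that for all $z\in\mathbb{D}^2$ and all $(p_1,p_2)\in\mathbb{Z}_+^2$: $\frac{|F^{(p_1,p_2)}(z)|}{p_1!p_2!\,l_1^{p_1}(z)l_2^{p_2}(z)}\le\max\{\frac{|F^{(k_1,k_2)}(z)|}{k_1!k_2!\,l_1^{k_1}(z)l_2^{k_2}(z)}:0\le k_1+k_2\le n_0\}$. $Q^2(\mathbb{D}^2)$ is the class of such $\mathbf{L}$ for which, for all $R=(r_1,r_2)\in[0,\beta]^2$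 and $j=1,2$, $0<\lambda_{1,j}(R)\le\lambda_{2,j}(R)<\infty$, where $\lambda_{1,j}(R)=\inf_{z^0\in\mathbb{D}^2}\inf\{l_j(z)/l_j(z^0): z\in\mathbb{D}^2[z^0,R/\mathbf{L}(z^0)]\}$ and $\lambda_{2,j}(R)=\sup_{z^0\in\mathbb{D}^2}\sup\{l_j(z)/l_j(z^0): z\in\mathbb{D}^2[z^0,R/\mathbf{L}(z^0)]\}$. *)

(* Defs.v *)
From Stdlib Require Import Reals ClassicalEpsilon.
From Coquelicot Require Import Coquelicot.
Open Scope R_scope.

Definition inD2 (z : C * C) : Prop := Cmod (fst z) < 1 /\ Cmod (snd z) < 1.

Definition cpolydisc (z0 : C * C) (r1 r2 : R) (z : C * C) : Prop :=
  Cmod (fst z - fst z0) <= r1 /\ Cmod (snd z - snd z0) <= r2.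

Definition analytic_D2 (F : C * C -> C) : Prop :=
  forall z0, inD2 z0 -> exists r : R, 0 < r /\ exists a : nat -> nat -> C,
    forall z, Cmod (fst z - fst z0) < r -> Cmod (snd z - snd z0) < r ->
      (exists M : R, forall N, sum_n (fun i => sum_n (fun j =>
          Cmod (a i j) * Cmod (fst z - fst z0) ^ i * Cmod (snd z - snd z0) ^ j) N) N <= M) /\
      filterlim (fun N : nat => sum_n (fun i => sum_n (fun j =>
          (a i j * pow_n (fst z - fst z0) i * pow_n (snd z - snd z0) j)%C) N) N)
        eventually (locally (F z)).

(* complex derivative of f : C -> C at z (the unique l with f'(z) = l, when it exists) *)
Definition cderiv (f : C -> C) (z : C) : C :=
  epsilon (inhabits (0%R : C))
    (fun l => @is_derive C_AbsRing C_NormedModule f z l).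

Definition pd1 (F : C * C -> C) : C * C -> C :=
  fun z => cderiv (fun w => F (w, snd z)) (fst z).
Definition pd2 (F : C * C -> C) : C * C -> C :=
  fun z => cderiv (fun w => F (fst z, w)) (snd z).

Definition Fder (F : C * C -> C) (p q : nat) : C * C -> C :=
  Nat.iter p pd1 (Nat.iter q pd2 F).

Definition L_admissible (beta : R) (l1 l2 : C * C -> R) : Prop :=
  (forall z, inD2 z -> continuous l1 z /\ continuous l2 z) /\
  (forall z, inD2 z -> 0 <= l1 z /\ 0 <= l2 z) /\
  (forall z, inD2 z ->
     l1 z > beta / (1 - Cmod (fst z)) /\ l2 z > beta / (1 - Cmod (snd z))).

(* L in Q^2(D^2): for all R in [0,beta]^2 and j = 1,2,
   lambda_{1,j}(R) > 0 (a positive lower bound exists) and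
   lambda_{2,j}(R) < +oo (a finite upper bound exists);
   lambda_{1,j} <= lambda_{2,j} holds automatically. *)
Definition Q2 (beta : R) (l1 l2 : C * C -> R) : Prop :=
  forall r1 r2 : R, 0 <= r1 <= beta -> 0 <= r2 <= beta ->
  forall lj : C * C -> R, (lj = l1 \/ lj = l2) ->
  exists c1 c2 : R, 0 < c1 /\
    forall z0, inD2 z0 -> forall z, inD2 z ->
      cpolydisc z0 (r1 / l1 z0) (r2 / l2 z0) z ->
      c1 <= lj z / lj z0 <= c2.

Definition nder (F : C * C -> C) (l1 l2 : C * C -> R) (p1 p2 : nat) (z : C * C) : R :=
  Cmod (Fder F p1 p2 z) / (INR (Factorial.fact p1) * INR (Factorial.fact p2) * l1 z ^ p1 * l2 z ^ p2).

(* bounded L-index in joint variables (the max over the finite set is unfolded) *)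
Definition bounded_L_index_joint (F : C * C -> C) (l1 l2 : C * C -> R) : Prop :=
  exists n0 : nat, forall z, inD2 z -> forall p1 p2 : nat,
    exists k1 k2 : nat, (k1 + k2 <= n0)%nat /\
      nder F l1 l2 p1 p2 z <= nder F l1 l2 k1 k2 z.

(* Main.v *)
Require Import Defs.
From Stdlib Require Import Reals Lra Lia.
From Coquelicot Require Import Coquelicot.
Open Scope R_scope.

(** Write [W_k(z) = |F^(k)(z)| / (k! L(z0)^k)] for the derivatives normalized by the weight frozen
    at the centre [z0].

    (i) By the index hypothesis and the comparability of [L(z)] and [L(z0)] on the polydisc, every
    [W_p] with [|p| <= 2n+1] is at most a constant times some [W_m] with [|m| <= n].  Hence
    [V = sum of W_k^2 over k1, k2 <= n] satisfies [|V'| <= c V] along the two axis-parallel segments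
    leading from [z0] to [z], and Gronwall's inequality bounds [V(z)] by a constant times [V(z0)].
    Since all the [W_k] carry the same weights at [z] and [z0], the index [k] maximizing [W_k(z0)]
    has the required property.

    (ii) Take [R = (beta, beta)].  Cauchy's inequalities for [F^(k1,0)] on the polydisc bound the
    normalized derivative of order [(i + k1, j)] by [p / beta^(i+j)] times that of order [(k1, 0)],
    which suffices once [beta^(i+j) >= p]; derivatives of order [(i, j + k2)] are compared with
    order [(0, k2)] in the same way, and these two cases leave only finitely many orders.

    Cauchy's inequality itself follows by integrating over circles
    [d/dt (f(a + r e^(it)) e^(-i(n+1)t))], which gives
    [r c_n(f') = (n+1) c_(n+1)(f)] for the unnormalized Fourier coefficients [c_n] of [f] on the
    circle, and [c_0(f) = 2 pi f(a)]. *)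

(** * Double power series *)

Definition C_cv (u : nat -> C) (l : C) : Prop :=
  forall eps, 0 < eps -> exists N, forall n, (N <= n)%nat -> Cmod (u n - l) < eps.

Lemma C_cv_filterlim (u : nat -> C) (l : C) :
  filterlim u eventually (locally l) -> C_cv u l.
Proof.
  intros H eps He.
  (* Balls of the product structure on [C] are squares; the square of half-side [eps / sqrt 2] lies
     in the disc of radius [eps]. *)
  assert (He2 : 0 < eps / sqrt 2) by (apply Rdiv_lt_0_compat; auto; apply sqrt_lt_R0; lra).
  destruct (proj1 (filterlim_locally u l) H (mkposreal _ He2)) as [N HN].
  exists N; intros n Hn.
  specialize (HN n Hn).
  apply (C_NormedModule_mixin_compat2 l (u n)) in HN; simpl in HN.
  replace (sqrt 2 * (eps / sqrt 2)) with eps in HN; auto.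
  field; apply Rgt_not_eq, sqrt_lt_R0; lra.
Qed.

Lemma C_cv_unique (u : nat -> C) (l l' : C) : C_cv u l -> C_cv u l' -> l = l'.
Proof.
  intros H H'.
  destruct (Ceq_dec l l') as [e|ne]; auto; exfalso.
  assert (Hp : 0 < Cmod (l - l')) by (apply Cmod_gt_0, Cminus_eq_contra, ne).
  destruct (H (Cmod (l - l') / 2)) as [N HN]; [lra|].
  destruct (H' (Cmod (l - l') / 2)) as [N' HN']; [lra|].
  specialize (HN (N + N')%nat ltac:(lia)); specialize (HN' (N + N')%nat ltac:(lia)).
  assert (Ht := Cmod_triangle (u (N + N')%nat - l') (- (u (N + N')%nat - l))).
  rewrite Cmod_opp in Ht.
  replace (u (N + N')%nat - l' + - (u (N + N')%nat - l))%C with (l - l')%C in Ht by ring.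
  lra.
Qed.

Lemma Cmod_sum_n (f : nat -> C) (N : nat) :
  Cmod (sum_n f N) <= sum_n (fun i => Cmod (f i)) N.
Proof.
  induction N as [|N IH].
  - rewrite !sum_O; lra.
  - rewrite !sum_Sn. eapply Rle_trans; [apply Cmod_triangle|].
    apply Rplus_le_compat_r, IH.
Qed.

Lemma sum_n_le_loc (f g : nat -> R) (N : nat) :
  (forall i, (i <= N)%nat -> f i <= g i) -> sum_n f N <= sum_n g N.
Proof.
  induction N as [|N IH]; intros H.
  - rewrite !sum_O; auto.
  - rewrite !sum_Sn; apply Rplus_le_compat; auto.
Qed.

Lemma sum_n_half (N : nat) : sum_n (fun i => (1 / 2) ^ i) N = 2 - (1 / 2) ^ N.
Proof.
  induction N as [|N IH].
  - rewrite sum_O; simpl; lra.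
  - rewrite sum_Sn, IH; unfold plus; simpl; lra.
Qed.

Lemma sum_n_geom_le (f : nat -> R) (K : R) (N : nat) :
  0 <= K -> (forall i, f i <= K * (1 / 2) ^ i) -> sum_n f N <= 2 * K.
Proof.
  intros HK H.
  apply Rle_trans with (sum_n (fun i => K * (1 / 2) ^ i) N).
  - apply sum_n_le_loc; auto.
  - rewrite (sum_n_mult_l (K := R_Ring) K), sum_n_half; unfold mult; simpl.
    assert (0 <= (1 / 2) ^ N) by (apply pow_le; lra). nra.
Qed.

Lemma Cmod_sum_n_geom (f : nat -> C) (K : R) (N : nat) :
  0 <= K -> (forall i, Cmod (f i) <= K * (1 / 2) ^ i) -> Cmod (sum_n f N) <= 2 * K.
Proof.
  intros HK H; eapply Rle_trans; [apply Cmod_sum_n|]; apply sum_n_geom_le; auto.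
Qed.

Lemma half_pow_small (K eps : R) : 0 <= K -> 0 < eps ->
  exists N, forall n, (N <= n)%nat -> K * (1 / 2) ^ n < eps.
Proof.
  intros HK He.
  assert (Hd : 0 < eps / (K + 1)) by (apply Rdiv_lt_0_compat; lra).
  destruct (pow_lt_1_zero (1 / 2) ltac:(rewrite Rabs_pos_eq; lra) _ Hd) as [N HN].
  exists N; intros n Hn; specialize (HN n Hn).
  assert (Hp : 0 < (1 / 2) ^ n) by (apply pow_lt; lra).
  rewrite Rabs_pos_eq in HN by lra.
  apply (Rmult_lt_compat_r (K + 1)) in HN; [|lra].
  unfold Rdiv in HN; rewrite Rmult_assoc, Rinv_l, Rmult_1_r in HN by lra.
  nra.
Qed.

(** Completeness of [C]: the series of increments is dominated by a geometric one, and its partial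
    sums telescope to [u (S m) - u 0]. *)
Lemma C_cv_of_geom_increments (u : nat -> C) (K : R) : 0 <= K ->
  (forall n, Cmod (u (S n) - u n) <= K * (1 / 2) ^ n) -> exists l, C_cv u l.
Proof.
  intros HK H.
  assert (Hs : ex_series (V := C_CompleteNormedModule) (fun n => (u (S n) - u n)%C)).
  { apply (ex_series_le (V := C_CompleteNormedModule) _ (fun n => K * (1 / 2) ^ n)).
    - exact H.
    - apply (ex_series_scal (V := R_NormedModule) K).
      apply ex_series_geom; rewrite Rabs_pos_eq; lra. }
  destruct Hs as [l Hl].
  apply C_cv_filterlim in Hl.
  exists (l + u 0%nat)%C; intros eps He.
  destruct (Hl eps He) as [N HN]; exists (S N); intros n Hn.
  destruct n as [|n]; [lia|].
  specialize (HN n ltac:(lia)).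
  assert (E : forall m, sum_n (G := C_AbelianMonoid) (fun n => (u (S n) - u n)%C) m
                        = (u (S m) - u 0%nat)%C).
  { induction m as [|m IH].
    - now rewrite sum_O.
    - rewrite sum_Sn, IH; unfold plus; simpl; ring. }
  change (Cmod (sum_n (G := C_AbelianMonoid) (fun n => (u (S n) - u n)%C) n - l) < eps) in HN.
  rewrite E in HN.
  now replace (u (S n) - (l + u 0%nat))%C with (u (S n) - u 0%nat - l)%C by ring.
Qed.

(** * Complex differentiability *)

Definition is_C_deriv (f : C -> C) (z l : C) : Prop :=
  forall eps, 0 < eps -> exists d, 0 < d /\
    forall h, Cmod h < d -> Cmod (f (z + h)%C - f z - h * l) <= eps * Cmod h.

Lemma is_C_deriv_iff (f : C -> C) (z l : C) :
  is_C_deriv f z l <-> @is_derive C_AbsRing C_NormedModule f z l.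
Proof.
  split.
  - intros H; split; [apply is_linear_scal_l|].
    intros x Hx.
    apply (@is_filter_lim_locally_unique C_AbsRing (AbsRing_NormedModule C_AbsRing)) in Hx.
    subst x. intros eps.
    destruct (H eps (cond_pos eps)) as [d [Hd Hd']].
    exists (mkposreal d Hd); intros y Hy.
    specialize (Hd' (y - z)%C Hy).
    assert (E : forall y : C, (z + (y - z))%C = y) by (intros; ring).
    rewrite E in Hd'; exact Hd'.
  - intros [_ H] eps He.
    specialize (H z (fun P HP => HP) (mkposreal eps He)).
    destruct H as [d Hd].
    exists d; split; [apply cond_pos|]; intros h Hh.
    assert (E : (z + h - z)%C = h) by ring.
    specialize (Hd (z + h)%C).
    unfold ball in Hd; simpl in Hd; unfold AbsRing_ball, abs, minus, plus, opp in Hd; simpl in Hd.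
    fold (Cminus (z + h) z) in Hd; rewrite E in Hd.
    exact (Hd Hh).
Qed.

(** Once a derivative exists, the value chosen by [epsilon] is one, and derivatives are unique. *)
Lemma cderiv_eq (f : C -> C) (z l : C) : is_C_deriv f z l -> cderiv f z = l.
Proof.
  intros H; apply is_C_deriv_iff in H.
  assert (H' : @is_derive C_AbsRing C_NormedModule f z (cderiv f z)).
  { apply (ClassicalEpsilon.epsilon_spec (inhabits (RtoC 0))
      (fun l => @is_derive C_AbsRing C_NormedModule f z l)).
    now exists l. }
  rewrite <- (is_C_derive_unique f z l H).
  symmetry; now apply is_C_derive_unique.
Qed.

(** * Term-by-term differentiation of double series *)

Definition square_sum (a : nat -> nat -> C) (x y : C) (N : nat) : C :=
  sum_n (fun i => sum_n (fun j => a i j * Cpow x i * Cpow y j)%C N) N.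

(** [rho] plays the role of a reciprocal radius: the double series converges absolutely when both
    variables have modulus less than [1 / rho]. *)
Definition geom_bounded (K rho : R) (a : nat -> nat -> C) : Prop :=
  forall i j, Cmod (a i j) <= K * rho ^ i * rho ^ j.

Definition shift1 (a : nat -> nat -> C) (i j : nat) : C := (INR (S i) * a (S i) j)%C.

Lemma INR_le_pow2 (n : nat) : INR (S n) <= 2 ^ n.
Proof.
  induction n as [|n IH]; [simpl; lra|].
  rewrite S_INR; simpl (2 ^ S n).
  assert (1 <= 2 ^ n) by (apply pow_R1_Rle; lra). lra.
Qed.

Lemma geom_bounded_K_ge0 K rho a : geom_bounded K rho a -> 0 <= K.
Proof.
  intros H; specialize (H 0%nat 0%nat); simpl in H.
  assert (H0 := Cmod_ge_0 (a 0%nat 0%nat)); lra.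
Qed.

(** The factor [S i] produced by differentiation is at most [2 ^ i] and is absorbed by doubling
    [rho]; the rate in the second index is doubled as well, to keep a single rate for both. *)
Lemma geom_bounded_shift1 K rho a : 0 < rho ->
  geom_bounded K rho a -> geom_bounded (K * rho) (2 * rho) (shift1 a).
Proof.
  intros Hr H i j; unfold shift1.
  assert (HK := geom_bounded_K_ge0 _ _ _ H).
  rewrite Cmod_mult, Cmod_R, Rabs_pos_eq by apply pos_INR.
  apply Rle_trans with (2 ^ i * (K * rho ^ S i * rho ^ j)).
  - apply Rmult_le_compat; auto using pos_INR, Cmod_ge_0, INR_le_pow2.
  - rewrite !Rpow_mult_distr; simpl.
    assert (1 <= 2 ^ j) by (apply pow_R1_Rle; lra).
    assert (0 <= 2 ^ i * K * rho * rho ^ i * rho ^ j).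
    { repeat apply Rmult_le_pos; try apply pow_le; lra. }
    nra.
Qed.

Lemma geom_term_le (q x rho : R) (i : nat) : 0 <= x -> 0 <= rho -> x * rho <= q ->
  rho ^ i * x ^ i <= q ^ i.
Proof.
  intros Hx Hr H; rewrite <- Rpow_mult_distr; apply pow_incr; split; [nra|lra].
Qed.

Lemma square_sum_term_le K rho a x y i j : 0 < rho -> geom_bounded K rho a ->
  Cmod x * rho <= 1 / 2 -> Cmod y * rho <= 1 / 2 ->
  Cmod (a i j * Cpow x i * Cpow y j) <= K * (1 / 2) ^ i * (1 / 2) ^ j.
Proof.
  intros Hr H Hx Hy; rewrite !Cmod_mult, !Cmod_pow.
  assert (HK := geom_bounded_K_ge0 _ _ _ H).
  assert (H1 := geom_term_le _ _ _ i (Cmod_ge_0 x) (Rlt_le _ _ Hr) Hx).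
  assert (H2 := geom_term_le _ _ _ j (Cmod_ge_0 y) (Rlt_le _ _ Hr) Hy).
  assert (Hxi := pow_le _ i (Cmod_ge_0 x)).
  assert (Hyj := pow_le _ j (Cmod_ge_0 y)).
  assert (Hri := pow_lt _ i Hr). assert (Hrj := pow_lt _ j Hr).
  apply Rle_trans with (K * rho ^ i * rho ^ j * Cmod x ^ i * Cmod y ^ j).
  - repeat apply Rmult_le_compat_r; auto.
  - replace (K * rho ^ i * rho ^ j * Cmod x ^ i * Cmod y ^ j) with
      (K * ((rho ^ i * Cmod x ^ i) * (rho ^ j * Cmod y ^ j))) by ring.
    rewrite (Rmult_assoc K); apply Rmult_le_compat_l; auto.
    apply Rmult_le_compat; auto; apply Rmult_le_pos; auto using Rlt_le.
Qed.

(** Passing from the square of side [n] to the next one adds one column [B] and one row [D], each a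
    geometric sum of size at most [2 * K * (1 / 2) ^ n]. *)
Lemma square_sum_cv K rho a x y : 0 < rho -> geom_bounded K rho a ->
  Cmod x * rho <= 1 / 2 -> Cmod y * rho <= 1 / 2 -> exists l, C_cv (square_sum a x y) l.
Proof.
  intros Hr H Hx Hy.
  assert (HK := geom_bounded_K_ge0 _ _ _ H).
  assert (HT := fun i j => square_sum_term_le K rho a x y i j Hr H Hx Hy).
  apply C_cv_of_geom_increments with (4 * K); [lra|]; intros n.
  unfold square_sum.
  set (t := fun i j => (a i j * Cpow x i * Cpow y j)%C).
  change (Cmod (sum_n (fun i => sum_n (t i) (S n)) (S n) - sum_n (fun i => sum_n (t i) n) n)
    <= 4 * K * (1 / 2) ^ n).
  rewrite sum_Sn, (sum_n_ext _ (fun i => plus (sum_n (t i) n) (t i (S n))) n)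
    by (intros; apply sum_Sn).
  rewrite sum_n_plus.
  set (A := sum_n (fun i => sum_n (t i) n) n).
  set (B := sum_n (fun i => t i (S n)) n).
  set (D := sum_n (t (S n)) (S n)).
  unfold plus; simpl.
  replace (A + B + D - A)%C with (B + D)%C by ring.
  assert (Hp : 0 <= (1 / 2) ^ n) by (apply pow_le; lra).
  eapply Rle_trans; [apply Cmod_triangle|].
  assert (HB : Cmod B <= 2 * (K * (1 / 2) ^ n)).
  { apply Cmod_sum_n_geom; [nra|]; intros i.
    eapply Rle_trans; [apply HT|]; simpl.
    assert (0 <= (1 / 2) ^ i) by (apply pow_le; lra).
    assert (0 <= K * (1 / 2) ^ i * (1/2)^n) by (repeat apply Rmult_le_pos; auto).
    nra. }
  assert (HD : Cmod D <= 2 * (K * (1 / 2) ^ n)).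
  { apply Cmod_sum_n_geom; [nra|]; intros i.
    eapply Rle_trans; [apply HT|]; simpl.
    assert (0 <= (1 / 2) ^ i) by (apply pow_le; lra).
    assert (0 <= K * (1 / 2) ^ n * (1/2)^i) by (repeat apply Rmult_le_pos; auto).
    nra. }
  lra.
Qed.

(** Induction on the remainder [d]: the next one is [(x + h) d + h^2 (i + 1) x^i], and
    [n^2 + n <= (n + 1)^2] closes the step. Multiplying by [s ^ 2] avoids the exponent [i - 1]. *)
Lemma Cpow_second_order (x h : C) (s : R) (i : nat) : 0 < s ->
  Cmod x <= s -> Cmod (x + h) <= s ->
  Cmod (Cpow (x + h)%C (S i) - Cpow x (S i) - h * (INR (S i) * Cpow x i)) * s ^ 2
    <= Cmod h ^ 2 * (INR (S i) ^ 2 * s ^ S i).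
Proof.
  intros Hs Hx Hxh.
  induction i as [|i IH].
  - replace (Cpow (x + h)%C 1 - Cpow x 1 - h * (INR 1 * Cpow x 0))%C with (RtoC 0)
      by (simpl; ring).
    rewrite Cmod_0; simpl.
    assert (0 <= Cmod h * (Cmod h * 1)) by (assert (H := Cmod_ge_0 h); nra). nra.
  - set (d := (Cpow (x + h)%C (S i) - Cpow x (S i) - h * (INR (S i) * Cpow x i))%C) in *.
    replace (Cpow (x + h)%C (S (S i)) - Cpow x (S (S i)) - h * (INR (S (S i)) * Cpow x (S i)))%C
      with ((x + h) * d + h * h * (INR (S i) * Cpow x i))%C
      by (unfold d; rewrite (S_INR (S i)), RtoC_plus, !Cpow_S; ring).
    assert (Ht := Cmod_triangle ((x + h) * d) (h * h * (INR (S i) * Cpow x i))).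
    rewrite !Cmod_mult, Cmod_pow, Cmod_R, Rabs_pos_eq in Ht by apply pos_INR.
    assert (Hpi : Cmod x ^ i <= s ^ i) by (apply pow_incr; split; auto using Cmod_ge_0).
    assert (Hsi := pow_lt _ i Hs).
    assert (Hn := pos_INR (S i)).
    rewrite (S_INR (S i)); set (n := INR (S i)) in *.
    assert (Hd := Cmod_ge_0 d). assert (Hh := Cmod_ge_0 h).
    assert (H1 : Cmod (x + h) * Cmod d * s ^ 2 <= s * (Cmod h ^ 2 * (n ^ 2 * s ^ S i))).
    { apply Rle_trans with (s * (Cmod d * s ^ 2)).
      - rewrite Rmult_assoc; apply Rmult_le_compat_r; auto.
        apply Rmult_le_pos; auto; apply pow_le; lra.
      - apply Rmult_le_compat_l; lra. }
    assert (H2 : Cmod h * Cmod h * (n * Cmod x ^ i) * s ^ 2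
      <= Cmod h ^ 2 * (n * s ^ S (S i))).
    { replace (Cmod h ^ 2 * (n * s ^ S (S i))) with (Cmod h * Cmod h * (n * s ^ i) * s ^ 2)
        by (simpl; ring).
      apply Rmult_le_compat_r; [apply pow_le; lra|].
      apply Rmult_le_compat_l; [nra|]; apply Rmult_le_compat_l; auto. }
    apply Rle_trans with (s * (Cmod h ^ 2 * (n ^ 2 * s ^ S i)) + Cmod h ^ 2 * (n * s ^ S (S i))).
    + apply Rle_trans with ((Cmod (x + h) * Cmod d + Cmod h * Cmod h * (n * Cmod x ^ i)) * s ^ 2).
      * apply Rmult_le_compat_r; [apply pow_le; lra|auto].
      * lra.
    + replace (s * (Cmod h ^ 2 * (n ^ 2 * s ^ S i)) + Cmod h ^ 2 * (n * s ^ S (S i)))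
        with (Cmod h ^ 2 * ((n ^ 2 + n) * s ^ S (S i))) by (simpl; ring).
      apply Rmult_le_compat_l; [apply pow_le; auto|].
      apply Rmult_le_compat_r; [apply pow_le; lra|]. nra.
Qed.

Lemma C_sum_Sn (f : nat -> C) (n : nat) : sum_n f (S n) = (sum_n f n + f (S n))%C.
Proof. exact (sum_Sn (G := C_AbelianMonoid) f n). Qed.

(** The differentiated sum truncated at [N] already involves [B (S N)], which the undifferentiated
    sums lack; the last term corrects this mismatch. *)
Lemma power_sum_second_order_eq (B : nat -> C) (x h : C) (N : nat) :
  (sum_n (fun i => B i * Cpow (x + h) i)%C N - sum_n (fun i => B i * Cpow x i)%C N
    - h * sum_n (fun i => INR (S i) * B (S i) * Cpow x i)%C N)%C =
  (sum_n (fun i => B (S i) *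
      (Cpow (x + h) (S i) - Cpow x (S i) - h * (INR (S i) * Cpow x i)))%C N
    - B (S N) * (Cpow (x + h) (S N) - Cpow x (S N)))%C.
Proof.
  induction N as [|N IH].
  - rewrite !sum_O; simpl; ring.
  - rewrite !C_sum_Sn.
    match goal with |- _ = (?s + _ - _)%C =>
      match type of IH with ?l = (s - ?b)%C => replace s with (l + b)%C by (rewrite IH; ring) end end.
    rewrite !(Cpow_S _ (S N)); ring.
Qed.

(** Since [(i + 1)^2 <= 4^i] and [s * rho <= 1 / 8], the second-order remainders are dominated by a
    geometric series of ratio [1 / 2]; the boundary term decays geometrically in [N]. *)
Lemma power_sum_second_order_le (B : nat -> C) (K rho s : R) (x h : C) (N : nat) :
  0 <= K -> 0 < rho -> 0 < s -> s * rho <= 1 / 8 ->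
  (forall i, Cmod (B i) <= K * rho ^ i) -> Cmod x <= s -> Cmod (x + h) <= s ->
  Cmod (sum_n (fun i => B i * Cpow (x + h) i)%C N - sum_n (fun i => B i * Cpow x i)%C N
    - h * sum_n (fun i => INR (S i) * B (S i) * Cpow x i)%C N)
  <= 2 * (K / s ^ 2 * Cmod h ^ 2) + 2 * K * (1 / 2) ^ N.
Proof.
  intros HK Hr Hs Hsr HB Hx Hxh.
  rewrite power_sum_second_order_eq.
  eapply Rle_trans; [apply Cmod_triangle|]; rewrite Cmod_opp.
  assert (Hs2 : 0 < s ^ 2) by (apply pow_lt; auto).
  assert (Hks : 0 <= K / s ^ 2) by (apply Rmult_le_pos; auto; apply Rlt_le, Rinv_0_lt_compat; auto).
  assert (Hrs : forall i, rho ^ i * s ^ i <= (1 / 8) ^ i).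
  { intros i; apply geom_term_le; auto; lra. }
  apply Rplus_le_compat.
  - apply Cmod_sum_n_geom; [apply Rmult_le_pos; auto; apply pow_le, Cmod_ge_0|].
    intros i; rewrite Cmod_mult.
    assert (Hd := Cpow_second_order x h s i Hs Hx Hxh).
    set (d := Cmod (Cpow (x + h)%C (S i) - Cpow x (S i) - h * (INR (S i) * Cpow x i))) in *.
    assert (Hd' : d <= Cmod h ^ 2 * (INR (S i) ^ 2 * s ^ S i) / s ^ 2).
    { apply Rmult_le_reg_r with (s ^ 2); auto.
      unfold Rdiv; rewrite (Rmult_assoc _ (/ s ^ 2)), Rinv_l by lra; lra. }
    assert (Hh : 0 <= Cmod h ^ 2) by (apply pow_le, Cmod_ge_0).
    apply Rle_trans with (K * rho ^ S i * (Cmod h ^ 2 * (INR (S i) ^ 2 * s ^ S i) / s ^ 2)).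
    + apply Rmult_le_compat; auto using Cmod_ge_0. apply Cmod_ge_0.
    + replace (K * rho ^ S i * (Cmod h ^ 2 * (INR (S i) ^ 2 * s ^ S i) / s ^ 2))
        with (K / s ^ 2 * Cmod h ^ 2 * (INR (S i) ^ 2 * (rho ^ S i * s ^ S i)))
        by (field; lra).
      apply Rmult_le_compat_l; [apply Rmult_le_pos; auto|].
      apply Rle_trans with ((2 ^ i) ^ 2 * (1 / 8) ^ S i).
      * apply Rmult_le_compat; auto; try apply pow_le; auto using pos_INR.
        -- apply Rmult_le_pos; apply pow_le; lra.
        -- apply pow_incr; split; auto using pos_INR, INR_le_pow2.
      * rewrite <- pow_mult, Nat.mul_comm, pow_mult; simpl ((1 / 8) ^ S i).
        replace ((2 ^ 2) ^ i * (1 / 8 * (1 / 8) ^ i)) with (1 / 8 * ((2 ^ 2) ^ i * (1 / 8) ^ i))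
          by ring.
        rewrite <- Rpow_mult_distr. replace (2 ^ 2 * (1 / 8)) with (1 / 2) by lra.
        assert (0 <= (1 / 2) ^ i) by (apply pow_le; lra). lra.
  - rewrite Cmod_mult.
    assert (Hm : Cmod (Cpow (x + h) (S N) - Cpow x (S N)) <= 2 * s ^ S N).
    { eapply Rle_trans; [apply Cmod_triangle|]; rewrite Cmod_opp, !Cmod_pow.
      assert (Cmod x ^ S N <= s ^ S N) by (apply pow_incr; split; auto using Cmod_ge_0).
      assert (Cmod (x + h) ^ S N <= s ^ S N) by (apply pow_incr; split; auto using Cmod_ge_0).
      lra. }
    apply Rle_trans with (K * rho ^ S N * (2 * s ^ S N)).
    + apply Rmult_le_compat; auto using Cmod_ge_0.
    + replace (K * rho ^ S N * (2 * s ^ S N)) with (2 * K * (rho ^ S N * s ^ S N)) by ring.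
      apply Rmult_le_compat_l; [lra|].
      eapply Rle_trans; [apply Hrs|].
      apply Rle_trans with ((1 / 2) ^ S N); [apply pow_incr; lra|].
      simpl; assert (0 <= (1 / 2) ^ N) by (apply pow_le; lra). lra.
Qed.

Lemma square_sum_rows a x y N :
  square_sum a x y N =
  sum_n (fun i => sum_n (fun j => a i j * Cpow y j) N * Cpow x i)%C N.
Proof.
  unfold square_sum; apply sum_n_ext; intros i.
  rewrite (sum_n_ext _ (fun j => mult (K := C_Ring) (a i j * Cpow y j)%C (Cpow x i))).
  - apply (sum_n_mult_r (K := C_Ring)).
  - intros j; unfold mult; simpl; ring.
Qed.

(** Grouped by powers of [x], the double sum is a power sum whose coefficients [B i] are inner
    geometric sums, at most [2 * K * rho ^ i]; this reduces to one variable. *)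
Lemma square_sum_second_order K rho s a x h y N :
  0 < rho -> geom_bounded K rho a -> 0 < s -> s * rho <= 1 / 8 ->
  Cmod x <= s -> Cmod (x + h) <= s -> Cmod y <= s ->
  Cmod (square_sum a (x + h) y N - square_sum a x y N - h * square_sum (shift1 a) x y N)
  <= 2 * (2 * K / s ^ 2 * Cmod h ^ 2) + 2 * (2 * K) * (1 / 2) ^ N.
Proof.
  intros Hr H Hs Hsr Hx Hxh Hy.
  assert (HK := geom_bounded_K_ge0 _ _ _ H).
  rewrite !square_sum_rows.
  set (B := fun i => sum_n (fun j => a i j * Cpow y j)%C N).
  rewrite (sum_n_ext (fun i => sum_n (fun j => shift1 a i j * Cpow y j) N * Cpow x i)%C
    (fun i => INR (S i) * B (S i) * Cpow x i)%C).
  - apply power_sum_second_order_le with rho; auto; [lra|].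
    intros i; unfold B.
    replace (2 * K * rho ^ i) with (2 * (K * rho ^ i)) by ring.
    assert (Hri := pow_lt _ i Hr).
    apply Cmod_sum_n_geom; [nra|]; intros j.
    rewrite Cmod_mult, Cmod_pow.
    apply Rle_trans with (K * rho ^ i * rho ^ j * Cmod y ^ j).
    + apply Rmult_le_compat_r; auto; apply pow_le, Cmod_ge_0.
    + rewrite (Rmult_assoc _ (rho ^ j)); apply Rmult_le_compat_l; [nra|].
      apply geom_term_le; auto using Cmod_ge_0; nra.
  - intros i; f_equal; unfold B.
    rewrite (sum_n_ext _ (fun j => mult (K := C_Ring) (RtoC (INR (S i))) (a (S i) j * Cpow y j)%C)).
    + apply (sum_n_mult_l (K := C_Ring)).
    + intros j; unfold shift1, mult; simpl AbelianGroup.sort; cbn -[INR]; ring.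
Qed.

Lemma C_cv_minus u v l m : C_cv u l -> C_cv v m -> C_cv (fun n => u n - v n)%C (l - m)%C.
Proof.
  intros Hu Hv eps He.
  destruct (Hu (eps / 2)) as [N HN]; [lra|]. destruct (Hv (eps / 2)) as [N' HN']; [lra|].
  exists (N + N')%nat; intros n Hn.
  specialize (HN n ltac:(lia)); specialize (HN' n ltac:(lia)).
  replace (u n - v n - (l - m))%C with ((u n - l) + - (v n - m))%C by ring.
  eapply Rle_lt_trans; [apply Cmod_triangle|]; rewrite Cmod_opp; lra.
Qed.

Lemma C_cv_scal k u l : C_cv u l -> C_cv (fun n => k * u n)%C (k * l)%C.
Proof.
  intros Hu eps He.
  assert (Hk := Cmod_ge_0 k).
  destruct (Hu (eps / (Cmod k + 1))) as [N HN]; [apply Rdiv_lt_0_compat; lra|].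
  exists N; intros n Hn; specialize (HN n Hn).
  replace (k * u n - k * l)%C with (k * (u n - l))%C by ring; rewrite Cmod_mult.
  apply (Rmult_lt_compat_l (Cmod k + 1)) in HN; [|lra].
  replace ((Cmod k + 1) * (eps / (Cmod k + 1))) with eps in HN by (field; lra).
  assert (H := Cmod_ge_0 (u n - l)); nra.
Qed.

(** The geometric term is the truncation error left in bounds on partial sums; it vanishes in the
    limit. *)
Lemma C_cv_bound u l M K : 0 <= K -> C_cv u l ->
  (forall n, Cmod (u n) <= M + K * (1 / 2) ^ n) -> Cmod l <= M.
Proof.
  intros HK Hu HM; apply Rnot_lt_le; intros Hlt.
  destruct (Hu ((Cmod l - M) / 2)) as [N HN]; [lra|].
  destruct (half_pow_small K ((Cmod l - M) / 2) HK) as [N' HN']; [lra|].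
  specialize (HN (N + N')%nat ltac:(lia)); specialize (HN' (N + N')%nat ltac:(lia)).
  specialize (HM (N + N')%nat).
  assert (Ht := Cmod_triangle (u (N + N')%nat) (- (u (N + N')%nat - l))).
  replace (u (N + N')%nat + - (u (N + N')%nat - l))%C with l in Ht by ring.
  rewrite Cmod_opp in Ht; lra.
Qed.

(* The radius of the expansion is tied to the growth rate [rho] of the coefficients, so that
   differentiation, which replaces [rho] by [2 * rho], stays inside the domain. *)
Definition expansion (F : C * C -> C) (z0 : C * C) (a : nat -> nat -> C) : Prop :=
  exists K rho, 0 < rho /\ geom_bounded K rho a /\
    forall z, Cmod (fst z - fst z0) * rho < 1 / 8 -> Cmod (snd z - snd z0) * rho < 1 / 8 ->
      C_cv (square_sum a (fst z - fst z0)%C (snd z - snd z0)%C) (F z).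

(** The second-order estimate on partial sums passes to the limit in [N] and gives
    [|F(z + h) - F(z) - h l| <= M |h|^2] for small [h], hence differentiability. *)
Lemma expansion_deriv1 F z0 K rho a : 0 < rho -> geom_bounded K rho a ->
  (forall z, Cmod (fst z - fst z0) * rho < 1 / 8 -> Cmod (snd z - snd z0) * rho < 1 / 8 ->
      C_cv (square_sum a (fst z - fst z0)%C (snd z - snd z0)%C) (F z)) ->
  forall z, Cmod (fst z - fst z0) * (2 * rho) < 1 / 8 ->
    Cmod (snd z - snd z0) * (2 * rho) < 1 / 8 ->
    exists l, C_cv (square_sum (shift1 a) (fst z - fst z0)%C (snd z - snd z0)%C) l /\
      is_C_deriv (fun w => F (w, snd z)) (fst z) l.
Proof.
  intros Hr Ha HF [z1 z2]; simpl fst; simpl snd; intros H1 H2.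
  assert (HK := geom_bounded_K_ge0 _ _ _ Ha).
  set (x := (z1 - fst z0)%C) in *; set (y := (z2 - snd z0)%C) in *.
  assert (Hx := Cmod_ge_0 x). assert (Hy := Cmod_ge_0 y).
  destruct (square_sum_cv (K * rho) (2 * rho) (shift1 a) x y) as [l Hl];
    [lra|now apply geom_bounded_shift1|lra|lra|].
  exists l; split; auto.
  (* [s] is the radius of validity of the expansion; the hypothesis puts [x] within [s / 2], so
     increments shorter than [s / 2] stay inside. *)
  set (s := 1 / (8 * rho)).
  assert (Hs : 0 < s) by (apply Rdiv_lt_0_compat; lra).
  assert (Hsr : s * rho = 1 / 8) by (unfold s; field; lra).
  assert (Hs2 : 0 < s ^ 2) by (apply pow_lt; auto).
  set (M := 2 * (2 * K / s ^ 2)).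
  assert (HM : 0 <= M).
  { unfold M; apply Rmult_le_pos; [lra|]; apply Rmult_le_pos; [lra|].
    apply Rlt_le, Rinv_0_lt_compat; auto. }
  assert (Hq : forall h, Cmod h < s / 2 ->
    Cmod (F (z1 + h, z2)%C - F (z1, z2) - h * l) <= M * Cmod h ^ 2).
  { intros h Hh.
    assert (Hxh : Cmod (x + h) <= Cmod x + Cmod h) by apply Cmod_triangle.
    assert (Hxh' : Cmod (x + h) * rho < 1 / 8).
    { apply Rle_lt_trans with ((Cmod x + Cmod h) * rho); [apply Rmult_le_compat_r; lra|].
      nra. }
    assert (C1 := HF ((z1 + h)%C, z2)); assert (C2 := HF (z1, z2)); simpl fst in *; simpl snd in *.
    replace (z1 + h - fst z0)%C with (x + h)%C in C1 by (unfold x; ring).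
    specialize (C1 Hxh' ltac:(fold y; lra)); specialize (C2 ltac:(fold x; lra) ltac:(fold y; lra)).
    fold x y in C2; fold y in C1.
    apply (C_cv_bound _ _ _ (2 * (2 * K))
      ltac:(lra) (C_cv_minus _ _ _ _ (C_cv_minus _ _ _ _ C1 C2) (C_cv_scal h _ _ Hl))).
    intros N. eapply Rle_trans;
      [apply (square_sum_second_order K rho s a x h y N); auto; try lra|].
    - apply Rmult_le_reg_r with rho; lra.
    - apply Rmult_le_reg_r with rho; lra.
    - apply Rmult_le_reg_r with rho; lra.
    - unfold M; lra. }
  intros eps He.
  (* The second bound turns [M * |h|^2] into at most [eps * |h|]; the [+ 1] covers [M = 0]. *)
  exists (Rmin (s / 2) (eps / (M + 1))); split.
  - apply Rmin_glb_lt; [lra|apply Rdiv_lt_0_compat; lra].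
  - intros h Hh; simpl.
    assert (Hh1 := Rlt_le_trans _ _ _ Hh (Rmin_l _ _)).
    assert (Hh2 := Rlt_le_trans _ _ _ Hh (Rmin_r _ _)).
    eapply Rle_trans; [apply Hq; auto|].
    assert (Hh0 := Cmod_ge_0 h).
    simpl; rewrite Rmult_1_r, <- Rmult_assoc; apply Rmult_le_compat_r; auto.
    apply (Rmult_lt_compat_r (M + 1)) in Hh2; [|lra].
    replace (eps / (M + 1) * (M + 1)) with eps in Hh2 by (field; lra).
    nra.
Qed.

Lemma expansion_pd1 F z0 a : expansion F z0 a ->
  expansion (pd1 F) z0 (shift1 a) /\
  is_C_deriv (fun w => F (w, snd z0)) (fst z0) (pd1 F z0).
Proof.
  intros (K & rho & Hr & Ha & HF).
  assert (HD := expansion_deriv1 F z0 K rho a Hr Ha HF).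
  split.
  - exists (K * rho), (2 * rho); split; [lra|]; split; [now apply geom_bounded_shift1|].
    intros z H1 H2; destruct (HD z H1 H2) as (l & Hl & Hd).
    unfold pd1; now rewrite (cderiv_eq _ _ _ Hd).
  - assert (E : forall w : C, (w - w)%C = 0) by (intros; ring).
    destruct (HD z0) as (l & Hl & Hd); [rewrite E, Cmod_0; lra|rewrite E, Cmod_0; lra|].
    unfold pd1; now rewrite (cderiv_eq _ _ _ Hd).
Qed.

Lemma square_sum_0 a N : square_sum a 0 0 N = a 0%nat 0%nat.
Proof.
  rewrite square_sum_rows.
  assert (E : forall b, sum_n (fun i => b i * Cpow 0 i)%C N = b 0%nat).
  { intros b; induction N as [|N IH].
    - rewrite sum_O; simpl; ring.
    - rewrite sum_Sn, IH, Cpow_S; unfold plus; cbn -[Cpow]; ring. }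
  now rewrite E, E.
Qed.

Lemma expansion_at_center F z0 a : expansion F z0 a -> F z0 = a 0%nat 0%nat.
Proof.
  intros (K & rho & Hr & Ha & HF).
  assert (E : forall w : C, (w - w)%C = 0) by (intros; ring).
  specialize (HF z0); rewrite !E, Cmod_0 in HF.
  apply (C_cv_unique _ _ _ (HF ltac:(lra) ltac:(lra))).
  intros eps He; exists 0%nat; intros n _.
  now rewrite square_sum_0, E, Cmod_0.
Qed.

(** Exchanging the variables transfers the results on [pd1] to [pd2]. *)
Definition cswap (z : C * C) : C * C := (snd z, fst z).
Definition shift2 (a : nat -> nat -> C) (i j : nat) : C := (INR (S j) * a i (S j))%C.

Lemma expansion_swap F z0 a : expansion F z0 a ->
  expansion (fun z => F (cswap z)) (cswap z0) (fun i j => a j i).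
Proof.
  intros (K & rho & Hr & Ha & HF).
  exists K, rho; split; auto; split.
  - intros i j; specialize (Ha j i); lra.
  - intros z H1 H2; specialize (HF (cswap z) H2 H1).
    intros eps He; destruct (HF eps He) as [N HN]; exists N; intros n Hn.
    specialize (HN n Hn).
    replace (square_sum (fun i j => a j i) (fst z - fst (cswap z0)) (snd z - snd (cswap z0)) n)
      with (square_sum a (fst (cswap z) - fst z0) (snd (cswap z) - snd z0) n); auto.
    unfold square_sum; rewrite sum_n_switch.
    apply sum_n_ext; intros i; apply sum_n_ext; intros j; simpl; ring.
Qed.

(** By conversion, [pd2 F] is [pd1] of the swapped function, swapped back. *)
Lemma expansion_pd2 F z0 a : expansion F z0 a ->
  expansion (pd2 F) z0 (shift2 a) /\
  is_C_deriv (fun w => F (fst z0, w)) (snd z0) (pd2 F z0).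
Proof.
  intros H; apply expansion_swap, expansion_pd1 in H; destruct H as [H1 H2].
  split; auto.
  apply expansion_swap in H1; destruct z0; exact H1.
Qed.

(** * Analytic functions on the bidisc and their mixed derivatives *)

Definition analytic (F : C * C -> C) : Prop :=
  forall z0, inD2 z0 -> exists a, expansion F z0 a.

Lemma sum_n_ge_term (f : nat -> R) (N i : nat) :
  (forall i, 0 <= f i) -> (i <= N)%nat -> f i <= sum_n f N.
Proof.
  intros Hf; induction N as [|N IH]; intros Hi.
  - replace i with 0%nat by lia; rewrite sum_O; lra.
  - rewrite sum_Sn; unfold plus; simpl.
    destruct (Nat.eq_dec i (S N)) as [->|Hne]; [|specialize (IH ltac:(lia)); specialize (Hf (S N)); lra].
    assert (0 <= sum_n f N); [|lra].
    clear -Hf; induction N as [|N IH]; [rewrite sum_O; auto|].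
    rewrite sum_Sn; apply Rplus_le_le_0_compat; auto.
Qed.

(** Absolute convergence at the point displaced by [r / 2] in both variables bounds every
    [|a i j| (r / 2)^(i + j)] by [M], so [rho = 2 / r] serves. *)
Lemma analytic_D2_analytic F : analytic_D2 F -> analytic F.
Proof.
  intros H z0 Hz0; destruct (H z0 Hz0) as (r & Hr & a & Ha); exists a.
  assert (E : forall w : C, (w + r / 2 - w)%C = (r / 2)%R).
  { intros; rewrite RtoC_div by lra; field; apply RtoC_inj; lra. }
  assert (Er : Cmod (r / 2)%R = r / 2) by (rewrite Cmod_R, Rabs_pos_eq; lra).
  destruct (Ha ((fst z0 + r / 2)%C, (snd z0 + r / 2)%C)) as [[M HM] _]; simpl fst in *; simpl snd in *.
  - rewrite E, Er; lra.
  - rewrite E, Er; lra.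
  - rewrite !E, Er in HM.
    assert (Hp : forall i, 0 < (r / 2) ^ i) by (intros; apply pow_lt; lra).
    exists M, (2 / r); split; [apply Rdiv_lt_0_compat; lra|]; split.
    + intros i j.
      assert (Hij : Cmod (a i j) * (r / 2) ^ i * (r / 2) ^ j <= M).
      { eapply Rle_trans; [|apply (HM (i + j)%nat)].
        assert (Ht : forall i j, 0 <= Cmod (a i j) * (r / 2) ^ i * (r / 2) ^ j).
        { intros i' j'; repeat apply Rmult_le_pos; auto using Cmod_ge_0, Rlt_le. }
        eapply Rle_trans; [|apply (sum_n_ge_term _ _ i); [|lia]].
        - simpl; apply (sum_n_ge_term (fun j => Cmod (a i j) * (r / 2) ^ i * (r / 2) ^ j) _ j); auto; lia.
        - intros i'; eapply Rle_trans; [apply (Ht i' 0%nat)|].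
          apply (sum_n_ge_term (fun j => Cmod (a i' j) * (r / 2) ^ i' * (r / 2) ^ j) _ 0%nat); auto; lia. }
      replace (2 / r) with (/ (r / 2)) by (field; lra).
      rewrite !pow_inv.
      apply Rmult_le_reg_r with ((r / 2) ^ i * (r / 2) ^ j); [apply Rmult_lt_0_compat; auto|].
      replace (M * / (r / 2) ^ i * / (r / 2) ^ j * ((r / 2) ^ i * (r / 2) ^ j)) with M; [lra|].
      assert (Hi := Hp i); assert (Hj := Hp j); field; split; lra.
    + assert (Hc : forall t, t * (2 / r) < 1 / 8 -> t < r).
      { intros t Ht; apply (Rmult_lt_compat_r (r / 2)) in Ht; [|lra].
        replace (t * (2 / r) * (r / 2)) with t in Ht by (field; lra); lra. }
      intros z H1 H2; destruct (Ha z (Hc _ H1) (Hc _ H2)) as [_ Hl].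
      apply C_cv_filterlim in Hl.
      intros eps He; destruct (Hl eps He) as [N HN]; exists N; intros n Hn.
      exact (HN n Hn).
Qed.

Lemma analytic_pd1 F : analytic F -> analytic (pd1 F).
Proof.
  intros H z0 Hz0; destruct (H z0 Hz0) as [a Ha]; exists (shift1 a).
  now apply expansion_pd1.
Qed.

Lemma analytic_pd2 F : analytic F -> analytic (pd2 F).
Proof.
  intros H z0 Hz0; destruct (H z0 Hz0) as [a Ha]; exists (shift2 a).
  now apply expansion_pd2.
Qed.

(** Both sides are the constant coefficient of the doubly shifted expansion, namely [a 1 1]. *)
Lemma pd1_pd2_comm F z : analytic F -> inD2 z -> pd1 (pd2 F) z = pd2 (pd1 F) z.
Proof.
  intros H Hz; destruct (H z Hz) as [a Ha].
  rewrite (expansion_at_center _ _ _ (proj1 (expansion_pd1 _ _ _ (proj1 (expansion_pd2 _ _ _ Ha))))).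
  rewrite (expansion_at_center _ _ _ (proj1 (expansion_pd2 _ _ _ (proj1 (expansion_pd1 _ _ _ Ha))))).
  unfold shift1, shift2; ring.
Qed.

Lemma inD2_open1 z : inD2 z -> exists d, 0 < d /\
  forall h, Cmod h < d -> inD2 ((fst z + h)%C, snd z).
Proof.
  intros [H1 H2]; exists (1 - Cmod (fst z)); split; [lra|].
  intros h Hh; split; simpl; auto.
  eapply Rle_lt_trans; [apply Cmod_triangle|lra].
Qed.

(** A derivative depends only on nearby values and the bidisc is open. This is needed because the
    commutation of [pd1] and [pd2] is available only on the bidisc. *)
Lemma pd1_ext F G z : analytic F -> inD2 z -> (forall w, inD2 w -> F w = G w) ->
  pd1 F z = pd1 G z.
Proof.
  intros H Hz E; destruct (H z Hz) as [a Ha].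
  destruct (expansion_pd1 _ _ _ Ha) as [_ Hd].
  symmetry; apply cderiv_eq.
  destruct (inD2_open1 z Hz) as (d & Hd0 & Hd1).
  intros eps He; destruct (Hd eps He) as (d' & Hd0' & Hd1').
  exists (Rmin d d'); split; [now apply Rmin_glb_lt|].
  intros h Hh.
  assert (Hh1 := Rlt_le_trans _ _ _ Hh (Rmin_l _ _)).
  assert (Hh2 := Rlt_le_trans _ _ _ Hh (Rmin_r _ _)).
  specialize (Hd1' h Hh2); simpl in Hd1'.
  rewrite (E ((fst z + h)%C, snd z) (Hd1 h Hh1)) in Hd1'.
  rewrite (E (fst z, snd z)) in Hd1' by (now destruct z).
  exact Hd1'.
Qed.

Lemma analytic_Fder F p q : analytic F -> analytic (Fder F p q).
Proof.
  intros H; unfold Fder; induction p as [|p IH]; simpl; [|now apply analytic_pd1].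
  induction q as [|q IH]; simpl; auto; now apply analytic_pd2.
Qed.

(** [Fder] applies [pd2] innermost, so an additional [pd2] has to be moved past [p] copies of
    [pd1]. *)
Lemma pd2_Fder F p q z : analytic F -> inD2 z -> pd2 (Fder F p q) z = Fder F p (S q) z.
Proof.
  intros H; revert z; induction p as [|p IH]; intros z Hz; [reflexivity|].
  change (Fder F (S p) q) with (pd1 (Fder F p q)).
  change (Fder F (S p) (S q)) with (pd1 (Fder F p (S q))).
  rewrite <- pd1_pd2_comm; auto using analytic_Fder.
  apply pd1_ext; auto using analytic_Fder, analytic_pd2.
Qed.

Lemma Fder_deriv1 F p q z : analytic F -> inD2 z ->
  is_C_deriv (fun w => Fder F p q (w, snd z)) (fst z) (Fder F (S p) q z).
Proof.
  intros H Hz; destruct (analytic_Fder F p q H z Hz) as [a Ha].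
  exact (proj2 (expansion_pd1 _ _ _ Ha)).
Qed.

Lemma Fder_deriv2 F p q z : analytic F -> inD2 z ->
  is_C_deriv (fun w => Fder F p q (fst z, w)) (snd z) (Fder F p (S q) z).
Proof.
  intros H Hz; destruct (analytic_Fder F p q H z Hz) as [a Ha].
  rewrite <- pd2_Fder by auto.
  exact (proj2 (expansion_pd2 _ _ _ Ha)).
Qed.

(** * Cauchy's inequality *)

Lemma C_R_norm_Cmod (z : C) : @norm R_AbsRing C_R_NormedModule z = Cmod z.
Proof. symmetry; apply Cmod_norm. Qed.

(* Stated for real parts only: the imaginary part of [f] is the real part of [- i f]. *)
Lemma is_derive_Re_comp (f : C -> C) (l : C) (g1 g2 : R -> R) (d1 d2 t : R) :
  is_derive g1 t d1 -> is_derive g2 t d2 -> is_C_deriv f (g1 t, g2 t) l ->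
  is_derive (fun t => Re (f (g1 t, g2 t))) t (Re (l * (d1, d2))).
Proof.
  intros H1 H2 Hf; unfold is_derive.
  (* Seen as a function of two real variables, the real part of [f] has differential
     [Re (l * (x, y))]; the real chain rule then applies. *)
  assert (Hh : filterdiff (fun p : prod_NormedModule _ R_NormedModule R_NormedModule =>
      Re (f (fst p, snd p))) (locally (g1 t, g2 t)) (fun p => Re (l * (fst p, snd p)))).
  { split.
    - split.
      + intros [x1 x2] [y1 y2]; unfold plus; simpl; unfold plus; simpl; ring.
      + intros k [x1 x2]; unfold scal; simpl; unfold scal; simpl; unfold mult; simpl; ring.
      + exists (Cmod l + 1); assert (Hl := Cmod_ge_0 l); split; [lra|].
        intros [x1 x2].
        eapply Rle_trans; [apply re_le_Cmod|]; rewrite Cmod_mult; simpl.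
        change (Cmod l * Cmod (x1, x2) <= (Cmod l + 1) * @norm R_AbsRing C_R_NormedModule (x1, x2)).
        rewrite C_R_norm_Cmod.
        assert (Hx := Cmod_ge_0 (x1, x2)); nra.
    - intros x Hx.
      apply (is_filter_lim_locally_unique (V := prod_NormedModule _ R_NormedModule R_NormedModule)) in Hx.
      subst x; intros eps.
      destruct (Hf eps (cond_pos eps)) as (d & Hd & Hd').
      assert (Hs : 0 < sqrt 2) by (apply sqrt_lt_R0; lra).
      assert (Hds : 0 < d / sqrt 2) by (apply Rdiv_lt_0_compat; auto).
      exists (mkposreal _ Hds); intros y Hy.
      assert (Hy' := C_NormedModule_mixin_compat2 (g1 t, g2 t) y (mkposreal _ Hds) Hy).
      simpl in Hy'; replace (sqrt 2 * (d / sqrt 2)) with d in Hy' by (field; lra).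
      destruct y as [y1 y2].
      set (h := (y1 - g1 t, y2 - g2 t) : C).
      change (Cmod h < d) in Hy'.
      specialize (Hd' h Hy').
      assert (E : forall a b c d : R, ((a, b) + ((c - a)%R, (d - b)%R))%C = (c, d))
        by (intros; unfold Cplus; simpl; f_equal; ring).
      unfold h at 1 in Hd'; rewrite E in Hd'.
      change (Rabs (Re (f (y1, y2)) - Re (f (g1 t, g2 t)) - Re (l * h)) <=
        eps * @norm R_AbsRing C_R_NormedModule h).
      rewrite C_R_norm_Cmod.
      eapply Rle_trans; [|apply Hd'].
      replace (Re (f (y1, y2)) - Re (f (g1 t, g2 t)) - Re (l * h))
        with (Re (f (y1, y2) - f (g1 t, g2 t) - h * l)).
      + apply re_le_Cmod.
      + unfold Re; simpl; ring. }
  assert (Hc := filterdiff_comp'_2 g1 g2 (fun x y => Re (f (x, y))) t _ _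
    (fun x y => Re (l * (x, y))) H1 H2 Hh).
  apply filterdiff_ext_lin with (1 := Hc).
  intros y; unfold scal, Re; simpl; unfold mult; simpl; ring.
Qed.

(** * Derivatives of complex-valued paths *)

Definition C_path_deriv (g : R -> C) (t : R) (l : C) : Prop :=
  is_derive (fun t => Re (g t)) t (Re l) /\ is_derive (fun t => Im (g t)) t (Im l).

Lemma is_C_deriv_scal k f z l : is_C_deriv f z l -> is_C_deriv (fun z => k * f z)%C z (k * l)%C.
Proof.
  intros H eps He; assert (Hk := Cmod_ge_0 k).
  destruct (H (eps / (Cmod k + 1))) as (d & Hd & Hd'); [apply Rdiv_lt_0_compat; lra|].
  exists d; split; auto; intros h Hh; specialize (Hd' h Hh).
  replace (k * f (z + h)%C - k * f z - h * (k * l))%C with (k * (f (z + h)%C - f z - h * l))%C by ring.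
  rewrite Cmod_mult.
  set (m := Cmod (f (z + h)%C - f z - h * l)) in *.
  assert (Hm : 0 <= m) by apply Cmod_ge_0.
  apply (Rmult_le_compat_l (Cmod k + 1)) in Hd'; [|lra].
  replace ((Cmod k + 1) * (eps / (Cmod k + 1) * Cmod h)) with (eps * Cmod h) in Hd'
    by (field; lra).
  nra.
Qed.

Lemma C_path_deriv_ext g g' t l : (forall t, g t = g' t) -> C_path_deriv g t l -> C_path_deriv g' t l.
Proof.
  intros E [H1 H2]; split.
  - apply is_derive_ext with (2 := H1); intros; now rewrite E.
  - apply is_derive_ext with (2 := H2); intros; now rewrite E.
Qed.

Lemma C_path_deriv_comp f g t l d : is_C_deriv f (g t) l -> C_path_deriv g t d ->
  C_path_deriv (fun t => f (g t)) t (l * d)%C.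
Proof.
  intros Hf [H1 H2].
  assert (Hp : forall z : C, (Re z, Im z) = z) by now intros [].
  assert (HR : forall f l, is_C_deriv f (g t) l ->
    is_derive (fun t => Re (f (g t))) t (Re (l * d))).
  { intros f' l' Hf'.
    assert (Hc := is_derive_Re_comp f' l' _ _ _ _ t H1 H2).
    cbv beta in Hc; rewrite !Hp in Hc; specialize (Hc Hf').
    apply is_derive_ext with (2 := Hc); intros; now rewrite Hp. }
  split; [now apply HR|].
  assert (Hi := HR _ _ (is_C_deriv_scal (- Ci)%C _ _ _ Hf)).
  replace (Re (- Ci * l * d)) with (Im (l * d)) in Hi by (unfold Re, Im; simpl; ring).
  apply is_derive_ext with (2 := Hi); intros; unfold Re, Im; simpl; ring.
Qed.

Lemma C_path_deriv_const k t : C_path_deriv (fun _ => k) t 0.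
Proof.
  split; [exact (is_derive_const (V := R_NormedModule) (Re k) t)
         |exact (is_derive_const (V := R_NormedModule) (Im k) t)].
Qed.

Lemma C_path_deriv_mult g h t l m : C_path_deriv g t l -> C_path_deriv h t m ->
  C_path_deriv (fun t => g t * h t)%C t (l * h t + g t * m)%C.
Proof.
  intros [G1 G2] [H1 H2]; split.
  - evar_last.
    + apply (is_derive_minus (fun t => Re (g t) * Re (h t)) (fun t => Im (g t) * Im (h t)));
      apply (is_derive_mult (K := R_AbsRing)); eauto; intros; apply Rmult_comm.
    + unfold minus, plus, opp, mult, Re, Im; simpl; ring.
  - evar_last.
    + apply (is_derive_plus (fun t => Re (g t) * Im (h t)) (fun t => Im (g t) * Re (h t)));
      apply (is_derive_mult (K := R_AbsRing)); eauto; intros; apply Rmult_comm.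
    + unfold minus, plus, opp, mult, Re, Im; simpl; ring.
Qed.

Lemma C_path_deriv_plus g h t l m : C_path_deriv g t l -> C_path_deriv h t m ->
  C_path_deriv (fun t => g t + h t)%C t (l + m)%C.
Proof.
  intros [G1 G2] [H1 H2]; split;
    [exact (is_derive_plus _ _ _ _ _ G1 H1)|exact (is_derive_plus _ _ _ _ _ G2 H2)].
Qed.

Lemma C_path_deriv_pow g t l n : C_path_deriv g t l ->
  C_path_deriv (fun t => Cpow (g t) (S n)) t (INR (S n) * Cpow (g t) n * l)%C.
Proof.
  intros H; induction n as [|n IH].
  - apply C_path_deriv_ext with g; [intros; simpl; ring|].
    replace (INR 1 * Cpow (g t) 0 * l)%C with l by (simpl; ring); auto.
  - assert (Hm := C_path_deriv_mult _ _ _ _ _ H IH).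
    replace (INR (S (S n)) * Cpow (g t) (S n) * l)%C
      with (l * Cpow (g t) (S n) + g t * (INR (S n) * Cpow (g t) n * l))%C.
    + exact Hm.
    + rewrite (S_INR (S n)), RtoC_plus, !Cpow_S; ring.
Qed.

(** * Fourier coefficients on circles *)

Definition cis (t : R) : C := (cos t, sin t).

Lemma C_path_deriv_cis t : C_path_deriv cis t (Ci * cis t)%C.
Proof.
  split; unfold Re, Im; simpl; evar_last.
  - apply is_derive_Reals, derivable_pt_lim_cos.
  - simpl; ring.
  - apply is_derive_Reals, derivable_pt_lim_sin.
  - simpl; ring.
Qed.

Lemma C_path_deriv_conj g t l : C_path_deriv g t l ->
  C_path_deriv (fun t => Cconj (g t)) t (Cconj l).
Proof.
  intros [H1 H2]; split; [exact H1|].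
  exact (is_derive_opp _ _ _ H2).
Qed.

Lemma cis_conj t : (cis t * Cconj (cis t))%C = 1.
Proof.
  unfold cis, Cconj, Cmult; simpl; assert (H := sin2_cos2 t); unfold Rsqr in H.
  apply injective_projections; simpl; [lra|ring].
Qed.

Lemma Cmod_cis t : Cmod (cis t) = 1.
Proof.
  unfold Cmod, cis; simpl.
  assert (H := sin2_cos2 t); unfold Rsqr in H.
  replace (cos t * (cos t * 1) + sin t * (sin t * 1)) with 1 by lra; apply sqrt_1.
Qed.

Lemma cis_2PI : cis (2 * PI) = cis 0.
Proof. unfold cis; now rewrite cos_2PI, sin_2PI, cos_0, sin_0. Qed.

(** Real part of [w] times the unnormalized [n]-th Fourier coefficient of [f] on the circle of
    centre [a] and radius [r], the conjugate power being [e^(-int)]. The free factor [w] gives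
    access to the complex coefficient through real integrals. *)
Definition circle_coef (f : C -> C) (a w : C) (n : nat) (r : R) : R :=
  RInt (fun t => Re (w * f (a + r * cis t)%C * Cpow (Cconj (cis t)) n)) 0 (2 * PI).

Lemma C_path_deriv_circle a r t : C_path_deriv (fun t => a + r * cis t)%C t (r * (Ci * cis t))%C.
Proof.
  assert (H := C_path_deriv_plus _ _ _ _ _ (C_path_deriv_const a t)
    (C_path_deriv_mult _ _ _ _ _ (C_path_deriv_const r t) (C_path_deriv_cis t))).
  now replace (r * (Ci * cis t))%C with (0 + (0 * cis t + r * (Ci * cis t)))%C by ring.
Qed.

Lemma C_path_deriv_line a h t : C_path_deriv (fun t => a + t * h)%C t h.
Proof.
  assert (H : C_path_deriv (fun t => RtoC t) t 1).
  { split; unfold Re, Im; simpl; [exact (is_derive_id (K := R_AbsRing) t)|exact (is_derive_const (V := R_NormedModule) 0 t)]. }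
  assert (H' := C_path_deriv_plus _ _ _ _ _ (C_path_deriv_const a t)
    (C_path_deriv_mult _ _ _ _ _ H (C_path_deriv_const h t))).
  cbv beta in H'; replace (0 + (1 * h + t * 0))%C with h in H' by ring.
  exact H'.
Qed.

Lemma circle_in_disc a r t : Cmod a + Rabs r < 1 -> Cmod (a + r * cis t) < 1.
Proof.
  intros H; eapply Rle_lt_trans; [apply Cmod_triangle|].
  rewrite Cmod_mult, Cmod_cis, Cmod_R; lra.
Qed.

(** A sequence of successive derivatives given as data, so that the slices of [Fder] in either
    variable fit the same one-variable estimates. *)
Definition C_derivs_on_disc (f : nat -> C -> C) : Prop :=
  forall k z, Cmod z < 1 -> is_C_deriv (f k) z (f (S k) z).

Lemma C_path_deriv_circle_coef f a k w n r t : C_derivs_on_disc f -> Cmod a + Rabs r < 1 ->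
  C_path_deriv (fun t => w * f k (a + r * cis t)%C * Cpow (Cconj (cis t)) n)%C t
    (w * Ci * (r * (f (S k) (a + r * cis t)%C * cis t * Cpow (Cconj (cis t)) n)
             - INR n * (f k (a + r * cis t)%C * Cpow (Cconj (cis t)) n)))%C.
Proof.
  intros Hf Hr.
  assert (H1 := C_path_deriv_mult _ _ _ _ _ (C_path_deriv_const w t)
    (C_path_deriv_comp _ _ t _ _ (Hf k _ (circle_in_disc a r t Hr)) (C_path_deriv_circle a r t))).
  (* The power rule is stated for positive exponents, so exponent 0 is treated apart. *)
  destruct n as [|n].
  - assert (H2 := C_path_deriv_mult _ _ _ _ _ H1 (C_path_deriv_const 1 t)).
    cbv beta in H2.
    match type of H2 with C_path_deriv _ _ ?l => match goal with |- C_path_deriv _ _ ?m =>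
      replace m with l; [exact H2|simpl; ring] end end.
  - assert (H2 := C_path_deriv_mult _ _ _ _ _ H1
      (C_path_deriv_pow _ _ _ n (C_path_deriv_conj _ _ _ (C_path_deriv_cis t)))).
    cbv beta in H2.
    match type of H2 with C_path_deriv _ _ ?l => match goal with |- C_path_deriv _ _ ?m =>
      replace m with l; [exact H2|] end end.
    assert (E : Cconj (Ci * cis t) = (- Ci * Cconj (cis t))%C)
      by (apply injective_projections; simpl; ring).
    rewrite E, Cpow_S; ring.
Qed.

Lemma circle_integrand_continuous f a k w n r t : C_derivs_on_disc f -> Cmod a + Rabs r < 1 ->
  continuous (fun t => Re (w * f k (a + r * cis t)%C * Cpow (Cconj (cis t)) n)) t.
Proof.
  intros Hf Hr; apply (ex_derive_continuous (K := R_AbsRing) (V := R_NormedModule)); eexists.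
  exact (proj1 (C_path_deriv_circle_coef f a k w n r t Hf Hr)).
Qed.

Lemma ex_RInt_circle f a k w n r : C_derivs_on_disc f -> Cmod a + Rabs r < 1 ->
  ex_RInt (fun t => Re (w * f k (a + r * cis t)%C * Cpow (Cconj (cis t)) n)) 0 (2 * PI).
Proof.
  intros Hf Hr; apply (ex_RInt_continuous (V := R_CompleteNormedModule)).
  intros t _; now apply circle_integrand_continuous.
Qed.

(** A derivative of a function of period [2 * PI] integrates to zero over a period; here that
    derivative is [r * u t - INR (S n) * v t]. *)
Lemma circle_coef_step f a k w n r : C_derivs_on_disc f -> Cmod a + Rabs r < 1 ->
  r * circle_coef (f (S k)) a w n r = INR (S n) * circle_coef (f k) a w (S n) r.
Proof.
  intros Hf Hr; unfold circle_coef.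
  set (u := fun t => Re (w * f (S k) (a + r * cis t)%C * Cpow (Cconj (cis t)) n)).
  set (v := fun t => Re (w * f k (a + r * cis t)%C * Cpow (Cconj (cis t)) (S n))).
  (* The factor [- Ci] in the primitive cancels the [Ci] that comes from differentiating [cis]. *)
  assert (Hd : forall t, is_derive
    (fun t => Re (- Ci * w * f k (a + r * cis t)%C * Cpow (Cconj (cis t)) (S n))) t
    (minus (r * u t) (INR (S n) * v t))).
  { intros t; assert (H := proj1 (C_path_deriv_circle_coef f a k (- Ci * w)%C (S n) r t Hf Hr)).
    evar_last; [exact H|].
    assert (E : (- Ci * w * Ci * (r * (f (S k) (a + r * cis t)%C * cis t * Cpow (Cconj (cis t)) (S n))
             - INR (S n) * (f k (a + r * cis t)%C * Cpow (Cconj (cis t)) (S n))) =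
        r * (w * f (S k) (a + r * cis t)%C * Cpow (Cconj (cis t)) n)
        - INR (S n) * (w * f k (a + r * cis t)%C * Cpow (Cconj (cis t)) (S n)))%C).
    { assert (Ei : (Ci * Ci)%C = (- (1))%C)
        by (apply injective_projections; simpl; ring).
      transitivity (- (Ci * Ci) * w * (r * (f (S k) (a + r * cis t)%C * (cis t * Cconj (cis t)) * Cpow (Cconj (cis t)) n)
             - INR (S n) * (f k (a + r * cis t)%C * Cpow (Cconj (cis t)) (S n))))%C.
      - rewrite !Cpow_S; ring.
      - rewrite Ei, cis_conj; ring. }
    rewrite E; unfold u, v; rewrite <- !re_scal_l.
    unfold minus, plus, opp; simpl; ring. }
  assert (Hi := is_RInt_derive (V := R_CompleteNormedModule) _ _ 0 (2 * PI) (fun t _ => Hd t)).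
  cbv beta in Hi; rewrite cis_2PI in Hi.
  apply (is_RInt_unique (V := R_CompleteNormedModule)) in Hi.
  - rewrite (RInt_minus (V := R_CompleteNormedModule)) in Hi.
    + rewrite (RInt_scal (V := R_CompleteNormedModule) u), (RInt_scal (V := R_CompleteNormedModule) v) in Hi
        by (now apply ex_RInt_circle).
      rewrite minus_eq_zero in Hi.
      change (r * RInt u 0 (2 * PI) - INR (S n) * RInt v 0 (2 * PI) = 0) in Hi; lra.
    + apply (ex_RInt_scal (V := R_CompleteNormedModule) u); now apply ex_RInt_circle.
    + apply (ex_RInt_scal (V := R_CompleteNormedModule) v); now apply ex_RInt_circle.
  - intros t _.
    apply (continuous_minus (V := R_NormedModule) (fun t => r * u t) (fun t => INR (S n) * v t)).
    + apply (continuous_scal_r (K := R_AbsRing) (V := R_NormedModule) r u).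
      now apply circle_integrand_continuous.
    + apply (continuous_scal_r (K := R_AbsRing) (V := R_NormedModule) (INR (S n)) v).
      now apply circle_integrand_continuous.
Qed.

(** * The mean value property *)

Lemma C_deriv_continuous f z l : is_C_deriv f z l ->
  filterlim f (@locally C_UniformSpace z) (@locally C_UniformSpace (f z)).
Proof.
  intros H; apply is_C_deriv_iff in H.
  intros P HP.
  assert (Hc := ex_derive_continuous (V := C_NormedModule) f z (ex_intro _ l H) P HP).
  (* The modulus and the product structure define the same neighbourhoods in [C]. *)
  now apply locally_C.
Qed.

Lemma continuous_C_pair (U : UniformSpace) (g1 g2 : U -> R) (x : U) :
  continuous g1 x -> continuous g2 x ->
  filterlim (fun y => (g1 y, g2 y)) (locally x) (@locally C_UniformSpace (g1 x, g2 x)).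
Proof.
  intros H1 H2; apply (filterlim_locally (U := C_UniformSpace)); intros eps.
  assert (H1' := proj1 (filterlim_locally g1 (g1 x)) H1 eps).
  assert (H2' := proj1 (filterlim_locally g2 (g2 x)) H2 eps).
  generalize (filter_and _ _ H1' H2'); apply filter_imp; intros y [Hy1 Hy2]; now split.
Qed.

(** Joint continuity in radius and angle, required for differentiating under the integral sign. *)
Lemma continuous_circle_integrand_2d (g : C -> C) (a w l : C) (r t : R) :
  is_C_deriv g (a + r * cis t)%C l ->
  continuity_2d_pt (fun u v => Re (w * (g (a + u * cis v)%C * cis v))) r t.
Proof.
  intros Hg; apply continuity_2d_pt_filterlim.
  set (U := prod_UniformSpace R_UniformSpace R_UniformSpace).
  assert (Hu : continuous (fun p : U => fst p) (r, t)) by apply continuous_fst.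
  assert (Hv : continuous (fun p : U => snd p) (r, t)) by apply continuous_snd.
  assert (Hcos : continuous (fun p : U => cos (snd p)) (r, t))
    by (apply (continuous_comp (fun p : U => snd p) cos); auto; apply continuous_cos).
  assert (Hsin : continuous (fun p : U => sin (snd p)) (r, t))
    by (apply (continuous_comp (fun p : U => snd p) sin); auto; apply continuous_sin).
  assert (Hm : forall g1 g2 : U -> R, continuous g1 (r, t) -> continuous g2 (r, t) ->
    continuous (fun p => g1 p * g2 p) (r, t))
    by (intros; apply (continuous_mult (K := R_AbsRing)); auto).
  assert (Hp : forall g1 g2 : U -> R, continuous g1 (r, t) -> continuous g2 (r, t) ->
    continuous (fun p => g1 p + g2 p) (r, t))
    by (intros; apply (continuous_plus (V := R_NormedModule)); auto).
  assert (Hs : forall g1 g2 : U -> R, continuous g1 (r, t) -> continuous g2 (r, t) ->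
    continuous (fun p => g1 p - g2 p) (r, t))
    by (intros; apply (continuous_minus (V := R_NormedModule)); auto).
  assert (Hk : forall c : R, continuous (fun _ : U => c) (r, t)) by (intros; apply continuous_const).
  assert (HG : filterlim (fun p : U => g (a + fst p * cis (snd p))%C) (locally (r, t))
    (@locally C_UniformSpace (g (a + r * cis t)%C))).
  { apply (filterlim_comp _ _ _ (fun p : U => (a + fst p * cis (snd p))%C) g _
      (@locally C_UniformSpace (a + r * cis t)%C)).
    (* The terms with factor 0 come from the imaginary part of the real radius; with them the
       components match [a + u * cis v] by conversion. *)
    - apply (continuous_C_pair U
        (fun p => Re a + (fst p * cos (snd p) - 0 * sin (snd p)))
        (fun p => Im a + (fst p * sin (snd p) + 0 * cos (snd p))) (r, t)); auto 10.
    - now apply C_deriv_continuous with l. }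
  assert (HG1 : continuous (fun p : U => Re (g (a + fst p * cis (snd p))%C)) (r, t)).
  { apply (filterlim_comp _ _ _ _ (fst : C -> R) _ _ _ HG).
    intros P HP; destruct HP as [e He]; exists e; intros y Hy; apply He; apply Hy. }
  assert (HG2 : continuous (fun p : U => Im (g (a + fst p * cis (snd p))%C)) (r, t)).
  { apply (filterlim_comp _ _ _ _ (snd : C -> R) _ _ _ HG).
    intros P HP; destruct HP as [e He]; exists e; intros y Hy; apply He; apply Hy. }
  exact (Hs _ _
    (Hm _ _ (Hk (Re w)) (Hs _ _ (Hm _ _ HG1 Hcos) (Hm _ _ HG2 Hsin)))
    (Hm _ _ (Hk (Im w)) (Hp _ _ (Hm _ _ HG1 Hsin) (Hm _ _ HG2 Hcos)))).
Qed.

(** The power with exponent 0 is kept so that the function is literally the integrand of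
    [circle_coef] at [n = 0]. *)
Lemma is_derive_radius f a k w r t : C_derivs_on_disc f -> Cmod a + Rabs r < 1 ->
  is_derive (fun r : R => Re (w * f k (a + r * cis t)%C * Cpow (Cconj (cis t)) 0)) r
    (Re (w * (f (S k) (a + r * cis t)%C * cis t))).
Proof.
  intros Hf Hr.
  assert (H := proj1 (C_path_deriv_mult _ _ _ _ _ (C_path_deriv_const w r)
    (C_path_deriv_comp _ _ r _ _ (Hf k _ (circle_in_disc a r t Hr)) (C_path_deriv_line a (cis t) r)))).
  cbv beta in H.
  evar_last.
  - apply is_derive_ext with (2 := H); intros u; f_equal; simpl; ring.
  - f_equal; ring.
Qed.

(** Differentiation under the integral sign; the condition [Cmod a + Rabs u < 1] is open in [u], so
    the integrands are regular for all radii near [r]. *)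
Lemma is_derive_circle_coef f a k w r : C_derivs_on_disc f -> Cmod a + Rabs r < 1 ->
  is_derive (circle_coef (f k) a w 0) r
    (RInt (fun t => Re (w * (f (S k) (a + r * cis t)%C * cis t))) 0 (2 * PI)).
Proof.
  intros Hf Hr.
  assert (Hloc : locally r (fun u : R => Cmod a + Rabs u < 1)).
  { exists (mkposreal (1 - Cmod a - Rabs r) ltac:(lra)); intros u Hu.
    unfold ball in Hu; simpl in Hu; unfold AbsRing_ball, abs, minus, plus, opp in Hu; simpl in Hu.
    assert (Ht : Rabs u <= Rabs r + Rabs (u + - r)).
    { eapply Rle_trans; [|apply Rabs_triang]; apply Req_le; f_equal.
      revert u Hu; change (forall u : R, Rabs (u + - r) < 1 - Cmod a - Rabs r -> u = r + (u + - r)).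
      intros; ring. }
    lra. }
  assert (HD : forall u t, Cmod a + Rabs u < 1 ->
    Derive (fun r : R => Re (w * f k (a + r * cis t)%C * Cpow (Cconj (cis t)) 0)) u
      = Re (w * (f (S k) (a + u * cis t)%C * cis t))).
  { intros u t Hu; apply is_derive_unique; now apply is_derive_radius. }
  evar_last.
  - apply is_derive_RInt_param.
    + generalize Hloc; apply filter_imp; intros u Hu t _; eexists; now apply is_derive_radius.
    + intros t _.
      apply continuity_2d_pt_ext_loc with (f := fun u t => Re (w * (f (S k) (a + u * cis t)%C * cis t))).
      * destruct Hloc as [d Hd]; exists d; intros u v Hu _; symmetry; apply HD, Hd, Hu.
      * eapply continuous_circle_integrand_2d; apply Hf; now apply circle_in_disc.
    + generalize Hloc; apply filter_imp; intros u Hu; now apply ex_RInt_circle.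
  - apply RInt_ext; intros t _; now apply HD.
Qed.

(* The derivative in [r] of the mean value over the circle is the integral of a derivative in [t],
   up to the factor [-i / r]. *)
Lemma circle_coef_0 f a k w r : C_derivs_on_disc f -> 0 <= r -> Cmod a + r < 1 ->
  circle_coef (f k) a w 0 r = 2 * PI * Re (w * f k a).
Proof.
  intros Hf Hr0 Hr.
  assert (Ha : forall u, 0 <= u <= r -> Cmod a + Rabs u < 1) by (intros; rewrite Rabs_pos_eq; lra).
  (* The primitive in [t] contains [1 / u], so radius 0 is excluded; the mean value theorem asks for
     the derivative only at interior radii. *)
  assert (Hz : forall u, 0 < u < r ->
    RInt (fun t => Re (w * (f (S k) (a + u * cis t)%C * cis t))) 0 (2 * PI) = 0).
  { intros u Hu.
    assert (Hd : forall t, is_derive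
      (fun t => Re (- Ci / u * w * f k (a + u * cis t)%C * Cpow (Cconj (cis t)) 0)) t
      (Re (w * (f (S k) (a + u * cis t)%C * cis t)))).
    { intros t; assert (H := proj1 (C_path_deriv_circle_coef f a k (- Ci / u * w)%C 0 u t Hf
        (Ha u ltac:(lra)))).
      evar_last; [exact H|]; f_equal.
      assert (Ei : (Ci * Ci)%C = (- (1))%C) by (apply injective_projections; simpl; ring).
      assert (Hu0 : RtoC u <> 0) by (intros E; apply RtoC_inj in E; lra).
      transitivity (- (Ci * Ci) * w * (f (S k) (a + u * cis t)%C * cis t))%C.
      - simpl; field; auto.
      - rewrite Ei; ring. }
    assert (Hi := is_RInt_derive (V := R_CompleteNormedModule) _ _ 0 (2 * PI) (fun t _ => Hd t)).
    cbv beta in Hi; rewrite cis_2PI, minus_eq_zero in Hi.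
    apply (is_RInt_unique (V := R_CompleteNormedModule)), Hi.
    intros t _.
    apply (ex_derive_continuous (K := R_AbsRing) (V := R_NormedModule)); eexists.
    assert (Hz : Cmod (a + u * cis t) < 1) by (apply circle_in_disc, Ha; lra).
    exact (proj1 (C_path_deriv_mult _ _ _ _ _ (C_path_deriv_const w t)
      (C_path_deriv_mult _ _ _ _ _
        (C_path_deriv_comp _ _ t _ _ (Hf (S k) _ Hz) (C_path_deriv_circle a u t))
        (C_path_deriv_cis t)))). }
  destruct (MVT_gen (circle_coef (f k) a w 0) 0 r (fun _ => 0)) as (c & _ & Hc).
  - intros u; rewrite Rmin_left, Rmax_right by lra; intros Hu.
    rewrite <- (Hz u Hu); apply is_derive_circle_coef; auto; apply Ha; lra.
  - intros u; rewrite Rmin_left, Rmax_right by lra; intros Hu.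
    apply continuity_pt_filterlim, (ex_derive_continuous (K := R_AbsRing) (V := R_NormedModule)).
    eexists; apply is_derive_circle_coef; auto.
  (* At radius 0 the integrand is constant, which fixes the value. *)
  - assert (H0 : circle_coef (f k) a w 0 0 = 2 * PI * Re (w * f k a)).
    { unfold circle_coef; transitivity (RInt (fun _ => Re (w * f k a)) 0 (2 * PI)).
      - apply RInt_ext; intros t _; rewrite Cmult_0_l, Cplus_0_r.
        change (Cpow (Cconj (cis t)) 0) with (RtoC 1); now rewrite Cmult_1_r.
      - rewrite RInt_const; unfold scal; simpl; unfold mult; simpl; ring. }
    lra.
Qed.

(** * Cauchy estimates in one and two variables *)

Lemma circle_coef_eq f a k w n r : C_derivs_on_disc f -> 0 <= r -> Cmod a + r < 1 ->
  INR (Factorial.fact n) * circle_coef (f k) a w n r = r ^ n * (2 * PI * Re (w * f (n + k)%nat a)).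
Proof.
  intros Hf Hr0 Hr; revert k; induction n as [|n IH]; intros k.
  - rewrite circle_coef_0 by auto; simpl; ring.
  - change (Factorial.fact (S n)) with (S n * Factorial.fact n)%nat; rewrite mult_INR.
    replace (INR (S n) * INR (Factorial.fact n) * circle_coef (f k) a w (S n) r) with
      (INR (Factorial.fact n) * (INR (S n) * circle_coef (f k) a w (S n) r)) by ring.
    (* Each step trades one Fourier index for one derivative and a factor [r], until the mean value
       property applies at index 0. *)
    rewrite <- circle_coef_step by (auto; rewrite Rabs_pos_eq; auto).
    replace (S n + k)%nat with (n + S k)%nat by lia.
    simpl (r ^ S n); rewrite Rmult_assoc, <- IH; ring.
Qed.

Lemma cauchy_estimate f a n r M : C_derivs_on_disc f -> 0 <= r -> Cmod a + r < 1 ->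
  (forall z, Cmod (z - a) <= r -> Cmod (f 0%nat z) <= M) ->
  Cmod (f n a) * r ^ n <= INR (Factorial.fact n) * M.
Proof.
  intros Hf Hr0 Hr HM.
  assert (Hn := INR_fact_lt_0 n).
  assert (HM0 : 0 <= M).
  { eapply Rle_trans; [apply Cmod_ge_0|apply (HM a)].
    replace (a - a)%C with (RtoC 0) by ring; now rewrite Cmod_0. }
  (* This choice turns [Re (w * f n a)] into [|f n a|^2]. One factor [|f n a|] is cancelled at the
     end, so its vanishing is a separate case. *)
  set (w := Cconj (f n a)).
  assert (Hw : Cmod w = Cmod (f n a)) by apply Cmod_conj.
  assert (Hww : Re (w * f n a) = Cmod (f n a) ^ 2).
  { rewrite Cmod2_alt; unfold w, Re, Im; simpl; ring. }
  assert (H := circle_coef_eq f a 0 w n r Hf Hr0 Hr).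
  rewrite Nat.add_0_r, Hww in H.
  assert (Hb : Rabs (circle_coef (f 0%nat) a w n r) <= (2 * PI - 0) * (Cmod (f n a) * M)).
  { assert (Hpi := PI_RGT_0).
    apply abs_RInt_le_const; [lra|apply ex_RInt_circle; auto; rewrite Rabs_pos_eq; auto|].
    intros t _; eapply Rle_trans; [apply re_le_Cmod|].
    rewrite !Cmod_mult, Cmod_pow, Cmod_conj, Cmod_cis, pow1, Hw, Rmult_1_r.
    apply Rmult_le_compat_l; [apply Cmod_ge_0|].
    apply HM. replace (a + r * cis t - a)%C with (r * cis t)%C by ring.
    rewrite Cmod_mult, Cmod_cis, Cmod_R, Rabs_pos_eq; lra. }
  assert (Hc := Rle_abs (circle_coef (f 0%nat) a w n r)).
  assert (Hm := Cmod_ge_0 (f n a)).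
  destruct (Req_dec (Cmod (f n a)) 0) as [->|Hne].
  - rewrite Rmult_0_l; apply Rmult_le_pos; lra.
  - assert (Hpi := PI_RGT_0).
    assert (H2 : r ^ n * (2 * PI * Cmod (f n a) ^ 2) <=
      INR (Factorial.fact n) * ((2 * PI - 0) * (Cmod (f n a) * M)))
      by (rewrite <- H; apply Rmult_le_compat_l; lra).
    apply Rmult_le_reg_l with (2 * PI * Cmod (f n a)); [nra|]. simpl in H2; lra.
Qed.

(** One variable at a time: first in [z1] at every [z2] of the closed disc, then in [z2] above the
    centre, with the first bound divided by [r1 ^ i] as the new upper bound. *)
Lemma cauchy_estimate_D2 F k1 k2 i j z0 r1 r2 M : analytic F -> inD2 z0 ->
  0 < r1 -> Cmod (fst z0) + r1 < 1 -> 0 < r2 -> Cmod (snd z0) + r2 < 1 ->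
  (forall z, inD2 z -> cpolydisc z0 r1 r2 z -> Cmod (Fder F k1 k2 z) <= M) ->
  Cmod (Fder F (i + k1) (j + k2) z0) * r1 ^ i * r2 ^ j
    <= INR (Factorial.fact i) * INR (Factorial.fact j) * M.
Proof.
  intros HF [Hz1 Hz2] Hr1 Hr1' Hr2 Hr2' HM.
  assert (Hin : forall (a z : C) r, Cmod a + r < 1 -> Cmod (z - a) <= r -> Cmod z < 1).
  { intros a z r Ha Hz; assert (Ht := Cmod_triangle a (z - a)).
    replace (a + (z - a))%C with z in Ht by ring; lra. }
  assert (H1 : forall z2, Cmod (z2 - snd z0) <= r2 ->
    Cmod (Fder F (i + k1) k2 (fst z0, z2)) * r1 ^ i <= INR (Factorial.fact i) * M).
  { intros z2 H2; assert (H2' := Hin _ _ _ Hr2' H2).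
    apply (cauchy_estimate (fun k w => Fder F (k + k1) k2 (w, z2)) (fst z0)); auto; [|lra|].
    - intros k w Hw; exact (Fder_deriv1 F (k + k1) k2 (w, z2) HF (conj Hw H2')).
    - intros w Hw; apply HM; split; simpl; auto; eauto. }
  assert (H2 := cauchy_estimate (fun k w => Fder F (i + k1) (k + k2) (fst z0, w)) (snd z0) j r2
    (INR (Factorial.fact i) * M / r1 ^ i)).
  assert (Hp : 0 < r1 ^ i) by (apply pow_lt; lra).
  assert (H3 : Cmod (Fder F (i + k1) (j + k2) (fst z0, snd z0)) * r2 ^ j
    <= INR (Factorial.fact j) * (INR (Factorial.fact i) * M / r1 ^ i)).
  { apply H2; auto; [|lra|].
    - intros k w Hw; exact (Fder_deriv2 F (i + k1) (k + k2) (fst z0, w) HF (conj Hz1 Hw)).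
    - intros w Hw; apply Rmult_le_reg_r with (r1 ^ i); auto.
      replace (INR (Factorial.fact i) * M / r1 ^ i * r1 ^ i) with (INR (Factorial.fact i) * M)
        by (field; lra).
      now apply H1. }
  rewrite <- surjective_pairing in H3.
  apply (Rmult_le_compat_r (r1 ^ i)) in H3; [|lra].
  replace (INR (Factorial.fact j) * (INR (Factorial.fact i) * M / r1 ^ i) * r1 ^ i)
    with (INR (Factorial.fact i) * INR (Factorial.fact j) * M) in H3 by (field; lra).
  lra.
Qed.

(** * From polydisc bounds to bounded index *)

Lemma fact_mult_le i k :
  INR (Factorial.fact i) * INR (Factorial.fact k) <= INR (Factorial.fact (i + k)).
Proof.
  rewrite <- mult_INR; apply le_INR; induction i as [|i IH]; [simpl; lia|].
  change (Factorial.fact (S i)) with (S i * Factorial.fact i)%nat.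
  change (Factorial.fact (S i + k)) with (S (i + k) * Factorial.fact (i + k))%nat.
  rewrite <- Nat.mul_assoc; apply Nat.mul_le_mono; lia.
Qed.

Lemma Rdiv_le_cross x y a b : 0 < a -> 0 < b -> x * b <= y * a -> x / a <= y / b.
Proof.
  intros Ha Hb H; apply Rmult_le_reg_r with (a * b); [nra|].
  replace (x / a * (a * b)) with (x * b) by (field; lra).
  replace (y / b * (a * b)) with (y * a) by (field; lra); auto.
Qed.

(** From [l * (1 - t) > beta >= r] the polydisc of radii [R / L] has its closure inside the
    bidisc. *)
Lemma L_radius_lt beta r l t : 0 < beta -> 0 < r <= beta -> t < 1 -> l > beta / (1 - t) ->
  0 < l /\ 0 < r / l /\ t + r / l < 1.
Proof.
  intros Hb Hr Ht Hl.
  assert (H0 : 0 < beta / (1 - t)) by (apply Rdiv_lt_0_compat; lra).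
  assert (Hl0 : 0 < l) by lra.
  split; auto; split; [apply Rdiv_lt_0_compat; lra|].
  apply (Rmult_lt_compat_r (1 - t)) in Hl; [|lra].
  replace (beta / (1 - t) * (1 - t)) with beta in Hl by (field; lra).
  apply Rmult_lt_reg_r with l; auto.
  replace ((t + r / l) * l) with (t * l + r) by (field; lra). lra.
Qed.

(** Cauchy's inequality with radii [beta / l1] and [beta / l2] yields a factor
    [p / beta^(i + j) <= 1]; then [i! k1! <= (i + k1)!], and likewise for [j], [k2], passes to the
    normalized derivatives. *)
Lemma nder_le_of_polydisc_bound beta l1 l2 F p k1 k2 i j z0 :
  1 < beta -> L_admissible beta l1 l2 -> analytic F -> inD2 z0 ->
  p <= beta ^ (i + j) ->
  (forall z, inD2 z -> cpolydisc z0 (beta / l1 z0) (beta / l2 z0) z ->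
     Cmod (Fder F k1 k2 z) <= p * Cmod (Fder F k1 k2 z0)) ->
  nder F l1 l2 (i + k1) (j + k2) z0 <= nder F l1 l2 k1 k2 z0.
Proof.
  intros Hb (_ & _ & HL) HF Hz Hp HM.
  destruct (HL z0 Hz) as [HL1 HL2]; destruct Hz as [Hz1 Hz2].
  destruct (L_radius_lt beta beta _ _ ltac:(lra) ltac:(lra) Hz1 HL1) as (Hl1 & Hr1 & Hs1).
  destruct (L_radius_lt beta beta _ _ ltac:(lra) ltac:(lra) Hz2 HL2) as (Hl2 & Hr2 & Hs2).
  assert (H := cauchy_estimate_D2 F k1 k2 i j z0 _ _ _ HF (conj Hz1 Hz2) Hr1 Hs1 Hr2 Hs2 HM).
  unfold nder.
  set (a := Cmod (Fder F (i + k1) (j + k2) z0)) in *.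
  set (g := Cmod (Fder F k1 k2 z0)) in *.
  assert (Hg : 0 <= g) by apply Cmod_ge_0.
  assert (Hpow : forall x n, 0 < x -> 0 < x ^ n) by (intros; now apply pow_lt).
  assert (Hf := INR_fact_lt_0).
  assert (Ha : a <= INR (Factorial.fact i) * INR (Factorial.fact j) * g * l1 z0 ^ i * l2 z0 ^ j).
  { unfold Rdiv in H; rewrite !Rpow_mult_distr, !pow_inv in H.
    assert (Hbij : 0 < beta ^ (i + j)) by (apply Hpow; lra).
    apply Rmult_le_reg_r with (beta ^ (i + j)); auto.
    apply (Rmult_le_compat_r (l1 z0 ^ i * l2 z0 ^ j)) in H;
      [|apply Rmult_le_pos; apply Rlt_le; auto].
    replace (a * (beta ^ i * / l1 z0 ^ i) * (beta ^ j * / l2 z0 ^ j) * (l1 z0 ^ i * l2 z0 ^ j))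
      with (a * beta ^ (i + j)) in H
      by (rewrite pow_add; field; split; apply Rgt_not_eq, Hpow; auto).
    eapply Rle_trans; [apply H|].
    replace (INR (Factorial.fact i) * INR (Factorial.fact j) * (p * g) * (l1 z0 ^ i * l2 z0 ^ j))
      with (INR (Factorial.fact i) * INR (Factorial.fact j) * g * l1 z0 ^ i * l2 z0 ^ j * p) by ring.
    apply Rmult_le_compat_l; auto.
    repeat apply Rmult_le_pos; auto using Rlt_le. }
  apply Rdiv_le_cross; [repeat apply Rmult_lt_0_compat; auto..|].
  assert (Hi := fact_mult_le i k1); assert (Hj := fact_mult_le j k2).
  rewrite !pow_add.
  apply Rle_trans with ((INR (Factorial.fact i) * INR (Factorial.fact k1)) *
    (INR (Factorial.fact j) * INR (Factorial.fact k2)) *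
    (g * (l1 z0 ^ i * l1 z0 ^ k1) * (l2 z0 ^ j * l2 z0 ^ k2))).
  - replace ((INR (Factorial.fact i) * INR (Factorial.fact k1)) *
    (INR (Factorial.fact j) * INR (Factorial.fact k2)) *
    (g * (l1 z0 ^ i * l1 z0 ^ k1) * (l2 z0 ^ j * l2 z0 ^ k2))) with
     (INR (Factorial.fact i) * INR (Factorial.fact j) * g * l1 z0 ^ i * l2 z0 ^ j *
      (INR (Factorial.fact k1) * INR (Factorial.fact k2) * l1 z0 ^ k1 * l2 z0 ^ k2)) by ring.
    apply Rmult_le_compat_r; auto.
    repeat apply Rmult_le_pos; auto using Rlt_le.
  - replace (g * (INR (Factorial.fact (i + k1)) * INR (Factorial.fact (j + k2)) *
       (l1 z0 ^ i * l1 z0 ^ k1) * (l2 z0 ^ j * l2 z0 ^ k2))) with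
      (INR (Factorial.fact (i + k1)) * INR (Factorial.fact (j + k2)) *
       (g * (l1 z0 ^ i * l1 z0 ^ k1) * (l2 z0 ^ j * l2 z0 ^ k2))) by ring.
    apply Rmult_le_compat_r; [repeat apply Rmult_le_pos; auto using Rlt_le|].
    apply Rmult_le_compat; auto; apply Rmult_le_pos; auto using Rlt_le.
Qed.

Lemma bounded_index_of_polydisc_bounds beta l1 l2 F n0 p :
  1 < beta -> L_admissible beta l1 l2 -> analytic F -> 1 <= p ->
  (forall z0, inD2 z0 ->
    exists k1 k2 : nat, (k1 <= n0)%nat /\ (k2 <= n0)%nat /\
      (forall z, inD2 z -> cpolydisc z0 (beta / l1 z0) (beta / l2 z0) z ->
         Cmod (Fder F k1 0 z) <= p * Cmod (Fder F k1 0 z0)) /\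
      (forall z, inD2 z -> cpolydisc z0 (beta / l1 z0) (beta / l2 z0) z ->
         Cmod (Fder F 0 k2 z) <= p * Cmod (Fder F 0 k2 z0))) ->
  bounded_L_index_joint F l1 l2.
Proof.
  intros Hb HL HF Hp H.
  destruct (Pow_x_infinity beta ltac:(rewrite Rabs_pos_eq; lra) p) as [N HN].
  assert (HN' : forall n, (N <= n)%nat -> p <= beta ^ n).
  { intros n Hn; specialize (HN n Hn); rewrite Rabs_pos_eq in HN; [lra|apply pow_le; lra]. }
  (* One [n0] pays for the order subtracted below; the other guarantees [k2 <= p2] whenever
     [p1 < k1]. *)
  exists (N + 2 * n0)%nat; intros z Hz p1 p2.
  destruct (H z Hz) as (k1 & k2 & Hk1 & Hk2 & H1 & H2).
  destruct (Compare_dec.le_lt_dec (p1 + p2) (N + 2 * n0)) as [Hle|Hlt].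
  - exists p1, p2; split; [auto|lra].
  (* If [p1 < k1 <= n0], then [p2 > N + n0 >= k2], so the second variable serves; in both cases at
     least [N] orders remain after the subtraction. *)
  - destruct (Compare_dec.le_lt_dec k1 p1) as [Hle1|Hlt1].
    + exists k1, 0%nat; split; [lia|].
      replace p1 with (p1 - k1 + k1)%nat by lia; replace p2 with (p2 + 0)%nat by lia.
      apply nder_le_of_polydisc_bound with beta p; auto; apply HN'; lia.
    + exists 0%nat, k2; split; [lia|].
      replace p1 with (p1 + 0)%nat by lia; replace p2 with (p2 - k2 + k2)%nat by lia.
      apply nder_le_of_polydisc_bound with beta p; auto; apply HN'; lia.
Qed.

(** * Growth of the derivatives along segments *)

(** The function [exp (- c * t) * V t] has non-positive derivative, so it does not increase from 0
    to 1. *)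
Lemma gronwall_exp (V dV : R -> R) (c : R) :
  (forall t, 0 <= t <= 1 -> is_derive V t (dV t)) ->
  (forall t, 0 <= t <= 1 -> dV t <= c * V t) -> V 1 <= exp c * V 0.
Proof.
  intros HV HdV.
  set (g := fun t => exp (- c * t) * V t).
  assert (Hg : forall t, 0 <= t <= 1 -> is_derive g t (exp (- c * t) * (dV t - c * V t))).
  { intros t Ht; unfold g; assert (HVt := HV t Ht); evar_last.
    - apply (is_derive_mult (K := R_AbsRing)); [|exact HVt|intros; apply Rmult_comm].
      auto_derive; auto; reflexivity.
    - unfold plus, mult; simpl; ring. }
  destruct (MVT_gen g 0 1 (fun t => exp (- c * t) * (dV t - c * V t))) as (t & Ht & E).
  - intros t; rewrite Rmin_left, Rmax_right by lra; intros Ht; apply Hg; lra.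
  - intros t; rewrite Rmin_left, Rmax_right by lra; intros Ht.
    apply continuity_pt_filterlim, (ex_derive_continuous (K := R_AbsRing) (V := R_NormedModule)).
    eexists; now apply Hg.
  - rewrite Rmin_left, Rmax_right in Ht by lra.
    specialize (HdV t Ht); assert (He := exp_pos (- c * t)).
    assert (Hle : g 1 <= g 0) by nra.
    unfold g in Hle; rewrite Rmult_0_r, exp_0, Rmult_1_r in Hle.
    assert (Hc : exp c * exp (- c) = 1) by (rewrite <- exp_plus, Rplus_opp_r; apply exp_0).
    assert (He' := exp_pos c).
    apply (Rmult_le_compat_l (exp c)) in Hle; [|lra].
    rewrite <- Rmult_assoc, Hc in Hle; lra.
Qed.

(** A sum of squares instead of a maximum, so that it is differentiable along segments. *)
Definition square_norm (n : nat) (g : nat -> nat -> C) : R :=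
  sum_n (fun k1 => sum_n (fun k2 => Cmod (g k1 k2) ^ 2) n) n.

Lemma square_norm_ge_term n g k1 k2 : (k1 <= n)%nat -> (k2 <= n)%nat ->
  Cmod (g k1 k2) ^ 2 <= square_norm n g.
Proof.
  intros H1 H2; unfold square_norm.
  apply Rle_trans with (sum_n (fun k2 => Cmod (g k1 k2) ^ 2) n).
  - apply (sum_n_ge_term (fun k2 => Cmod (g k1 k2) ^ 2)); auto; intros; apply pow2_ge_0.
  - apply (sum_n_ge_term (fun k1 => sum_n (fun k2 => Cmod (g k1 k2) ^ 2) n)); auto.
    intros i; eapply Rle_trans; [apply pow2_ge_0|].
    apply (sum_n_ge_term (fun k2 => Cmod (g i k2) ^ 2) n 0%nat); [intros; apply pow2_ge_0|lia].
Qed.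

Lemma double_sum_le_const n (u : nat -> nat -> R) M :
  (forall k1 k2, (k1 <= n)%nat -> (k2 <= n)%nat -> u k1 k2 <= M) ->
  sum_n (fun k1 => sum_n (fun k2 => u k1 k2) n) n <= INR (S n) ^ 2 * M.
Proof.
  intros H; apply Rle_trans with (sum_n (fun _ : nat => sum_n (fun _ => M) n) n).
  - apply sum_n_le_loc; intros i Hi; apply sum_n_le_loc; auto.
  - rewrite !sum_n_const; simpl; lra.
Qed.

Lemma C_path_deriv_Cmod2 g t l : C_path_deriv g t l ->
  is_derive (fun t => Cmod (g t) ^ 2) t (2 * Re (Cconj (g t) * l)).
Proof.
  intros [H1 H2].
  apply is_derive_ext with (fun t => Re (g t) * Re (g t) + Im (g t) * Im (g t)).
  - intros s; change (Re (g s) * Re (g s) + Im (g s) * Im (g s) = Cmod (g s) ^ 2).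
    rewrite Cmod2_alt; ring.
  - evar_last.
    + apply (is_derive_plus (fun t => Re (g t) * Re (g t)) (fun t => Im (g t) * Im (g t)));
      apply (is_derive_mult (K := R_AbsRing)); eauto; intros; apply Rmult_comm.
    + unfold plus, mult, Re, Im; simpl; ring.
Qed.

(** Each of the [(n + 1)^2] terms of the derivative is at most [2 B |g_k| |g_m| <= B (|g_k|^2 +
    |g_m|^2) <= 2 B V], and Gronwall's inequality applies. *)
Lemma square_norm_growth n (g dg : nat -> nat -> R -> C) B : 0 <= B ->
  (forall t k1 k2, 0 <= t <= 1 -> (k1 <= n)%nat -> (k2 <= n)%nat ->
    C_path_deriv (g k1 k2) t (dg k1 k2 t) /\
    exists m1 m2, (m1 <= n)%nat /\ (m2 <= n)%nat /\
      Cmod (dg k1 k2 t) <= B * Cmod (g m1 m2 t)) ->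
  square_norm n (fun k1 k2 => g k1 k2 1) <=
    exp (INR (S n) ^ 2 * (2 * B)) * square_norm n (fun k1 k2 => g k1 k2 0).
Proof.
  intros HB H.
  apply (gronwall_exp (fun t => square_norm n (fun k1 k2 => g k1 k2 t))
    (fun t => sum_n (fun k1 => sum_n (fun k2 => 2 * Re (Cconj (g k1 k2 t) * dg k1 k2 t)) n) n)).
  - intros t Ht; apply (is_derive_sum_n (V := R_NormedModule)
      (fun k1 t => sum_n (fun k2 => Cmod (g k1 k2 t) ^ 2) n)); intros k1 Hk1.
    apply (is_derive_sum_n (V := R_NormedModule) (fun k2 t => Cmod (g k1 k2 t) ^ 2)); intros k2 Hk2.
    apply C_path_deriv_Cmod2, H; auto.
  - intros t Ht; rewrite Rmult_assoc.
    apply double_sum_le_const; intros k1 k2 Hk1 Hk2.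
    destruct (H t k1 k2 Ht Hk1 Hk2) as (_ & m1 & m2 & Hm1 & Hm2 & Hd).
    assert (Hk := square_norm_ge_term n (fun k1 k2 => g k1 k2 t) k1 k2 Hk1 Hk2).
    assert (Hm := square_norm_ge_term n (fun k1 k2 => g k1 k2 t) m1 m2 Hm1 Hm2).
    set (V := square_norm n (fun k1 k2 => g k1 k2 t)) in *; simpl in Hk, Hm.
    assert (Hr := Rle_trans _ _ _ (Rle_abs _) (re_le_Cmod (Cconj (g k1 k2 t) * dg k1 k2 t))).
    rewrite Cmod_mult, Cmod_conj in Hr.
    set (x := Cmod (g k1 k2 t)) in *; set (y := Cmod (g m1 m2 t)) in *.
    assert (Hx : 0 <= x) by apply Cmod_ge_0.
    assert (Hxy : x * Cmod (dg k1 k2 t) <= x * (B * y)) by (apply Rmult_le_compat_l; auto).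
    assert (Hv : 2 * (x * y) <= 2 * V) by (assert (Hs := pow2_ge_0 (x - y)); simpl in Hs; lra).
    assert (B * (2 * (x * y)) <= B * (2 * V)) by (apply Rmult_le_compat_l; auto).
    lra.
Qed.

Lemma exists_max_le (f : nat -> R) n : exists k, (k <= n)%nat /\ forall i, (i <= n)%nat -> f i <= f k.
Proof.
  induction n as [|n (k & Hk & IH)].
  - exists 0%nat; split; auto; intros i Hi; replace i with 0%nat by lia; lra.
  - destruct (Rle_dec (f (S n)) (f k)) as [Hle|Hgt].
    + exists k; split; [lia|]; intros i Hi.
      destruct (Nat.eq_dec i (S n)) as [->|]; auto; apply IH; lia.
    + exists (S n); split; auto; intros i Hi.
      destruct (Nat.eq_dec i (S n)) as [->|]; [lra|].
      specialize (IH i ltac:(lia)); lra.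
Qed.

Lemma exists_max_square (f : nat -> nat -> R) n : exists k1 k2, (k1 <= n)%nat /\ (k2 <= n)%nat /\
  forall i j, (i <= n)%nat -> (j <= n)%nat -> f i j <= f k1 k2.
Proof.
  (* A column [h i] maximizing each row is chosen first; the best row is selected afterwards. *)
  destruct (ClassicalEpsilon.constructive_indefinite_description
    (fun h : nat -> nat => forall i, (h i <= n)%nat /\ forall j, (j <= n)%nat -> f i j <= f i (h i)))
    as [h Hh].
  { exists (fun i => proj1_sig (ClassicalEpsilon.constructive_indefinite_description _
      (exists_max_le (f i) n))).
    intros i; exact (proj2_sig (ClassicalEpsilon.constructive_indefinite_description _
      (exists_max_le (f i) n))). }
  destruct (exists_max_le (fun i => f i (h i)) n) as (k & Hk & Hmax).
  exists k, (h k); split; auto; split; [apply Hh|].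
  intros i j Hi Hj; eapply Rle_trans; [now apply Hh|auto].
Qed.

(** * Derivatives normalized by a frozen weight *)

Definition weight (a b : R) (k1 k2 : nat) : R :=
  INR (Factorial.fact k1) * INR (Factorial.fact k2) * a ^ k1 * b ^ k2.

(** With [a] and [b] constant this remains holomorphic in [z], unlike the quotients in [nder], whose
    weight varies with the point. *)
Definition wder (F : C * C -> C) (a b : R) (k1 k2 : nat) (z : C * C) : C :=
  (RtoC (/ weight a b k1 k2) * Fder F k1 k2 z)%C.

Lemma weight_pos a b k1 k2 : 0 < a -> 0 < b -> 0 < weight a b k1 k2.
Proof.
  intros; unfold weight; repeat apply Rmult_lt_0_compat; auto using INR_fact_lt_0, pow_lt.
Qed.

Lemma Cmod_wder F a b k1 k2 z : 0 < a -> 0 < b ->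
  Cmod (wder F a b k1 k2 z) = Cmod (Fder F k1 k2 z) / weight a b k1 k2.
Proof.
  intros Ha Hb; unfold wder; rewrite Cmod_mult, Cmod_R, Rabs_pos_eq.
  - unfold Rdiv; ring.
  - apply Rlt_le, Rinv_0_lt_compat, weight_pos; auto.
Qed.

(** Changing the weight costs at most one factor [c] per order of differentiation. *)
Lemma wder_change_weight F a b a' b' c p1 p2 z :
  0 < a -> 0 < b -> 0 < a' -> 0 < b' -> 0 <= c -> a' <= c * a -> b' <= c * b ->
  Cmod (wder F a b p1 p2 z) <= c ^ (p1 + p2) * Cmod (wder F a' b' p1 p2 z).
Proof.
  intros Ha Hb Ha' Hb' Hc Hac Hbc; rewrite !Cmod_wder by auto.
  assert (Hw := weight_pos a b p1 p2 Ha Hb); assert (Hw' := weight_pos a' b' p1 p2 Ha' Hb').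
  replace (c ^ (p1 + p2) * (Cmod (Fder F p1 p2 z) / weight a' b' p1 p2))
    with ((c ^ (p1 + p2) * Cmod (Fder F p1 p2 z)) / weight a' b' p1 p2) by (field; lra).
  apply Rdiv_le_cross; auto.
  replace (c ^ (p1 + p2) * Cmod (Fder F p1 p2 z) * weight a b p1 p2)
    with (Cmod (Fder F p1 p2 z) *
      (INR (Factorial.fact p1) * INR (Factorial.fact p2) * (c * a) ^ p1 * (c * b) ^ p2))
    by (unfold weight; rewrite pow_add, !Rpow_mult_distr; ring).
  apply Rmult_le_compat_l; [apply Cmod_ge_0|].
  assert (Hf1 := INR_fact_lt_0 p1); assert (Hf2 := INR_fact_lt_0 p2).
  assert (Hp1 : a' ^ p1 <= (c * a) ^ p1) by (apply pow_incr; lra).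
  assert (Hp2 : b' ^ p2 <= (c * b) ^ p2) by (apply pow_incr; lra).
  unfold weight; repeat apply Rmult_le_compat; auto; try lra;
    repeat apply Rmult_le_pos; try apply pow_le; lra.
Qed.

(** The factor [INR (S k1) * a] is the ratio of consecutive weights. *)
Lemma wder_deriv1 F a b k1 k2 z : analytic F -> 0 < a -> 0 < b -> inD2 z ->
  is_C_deriv (fun w => wder F a b k1 k2 (w, snd z)) (fst z)
    (RtoC (INR (S k1) * a) * wder F a b (S k1) k2 z)%C.
Proof.
  intros HF Ha Hb Hz.
  assert (H := is_C_deriv_scal (RtoC (/ weight a b k1 k2)) _ _ _ (Fder_deriv1 F k1 k2 z HF Hz)).
  replace (RtoC (INR (S k1) * a) * wder F a b (S k1) k2 z)%C
    with (RtoC (/ weight a b k1 k2) * Fder F (S k1) k2 z)%C; auto.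
  unfold wder; rewrite Cmult_assoc, <- RtoC_mult; f_equal; f_equal.
  assert (Hf1 := INR_fact_lt_0 k1); assert (Hf2 := INR_fact_lt_0 k2).
  assert (Hs := lt_0_INR (S k1) ltac:(lia)).
  assert (Hpa := pow_lt a k1 Ha); assert (Hpb := pow_lt b k2 Hb).
  unfold weight; change (Factorial.fact (S k1)) with (S k1 * Factorial.fact k1)%nat.
  rewrite mult_INR; change (a ^ S k1) with (a * a ^ k1); field; repeat split; lra.
Qed.

Lemma wder_deriv2 F a b k1 k2 z : analytic F -> 0 < a -> 0 < b -> inD2 z ->
  is_C_deriv (fun w => wder F a b k1 k2 (fst z, w)) (snd z)
    (RtoC (INR (S k2) * b) * wder F a b k1 (S k2) z)%C.
Proof.
  intros HF Ha Hb Hz.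
  assert (H := is_C_deriv_scal (RtoC (/ weight a b k1 k2)) _ _ _ (Fder_deriv2 F k1 k2 z HF Hz)).
  replace (RtoC (INR (S k2) * b) * wder F a b k1 (S k2) z)%C
    with (RtoC (/ weight a b k1 k2) * Fder F k1 (S k2) z)%C; auto.
  unfold wder; rewrite Cmult_assoc, <- RtoC_mult; f_equal; f_equal.
  assert (Hf1 := INR_fact_lt_0 k1); assert (Hf2 := INR_fact_lt_0 k2).
  assert (Hs := lt_0_INR (S k2) ltac:(lia)).
  assert (Hpa := pow_lt a k1 Ha); assert (Hpb := pow_lt b k2 Hb).
  unfold weight; change (Factorial.fact (S k2)) with (S k2 * Factorial.fact k2)%nat.
  rewrite mult_INR; change (b ^ S k2) with (b * b ^ k2); field; repeat split; lra.
Qed.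

(** [2 * n + 1] is the largest total order met when differentiating once a derivative of orders
    [k1, k2 <= n]. *)
Definition dominated (F : C * C -> C) (a b : R) (n : nat) (A : R) (z : C * C) : Prop :=
  forall p1 p2, (p1 + p2 <= 2 * n + 1)%nat -> exists m1 m2, (m1 + m2 <= n)%nat /\
    Cmod (wder F a b p1 p2 z) <= A * Cmod (wder F a b m1 m2 z).

(** The factor [a] produced by normalization is compensated by the length of the displacement, so
    the resulting rate does not depend on the weight. *)
Lemma directional_bound n k a A beta h u v : (k <= n)%nat -> 0 < a -> 0 <= A -> 0 <= v ->
  Cmod h * a <= beta -> Cmod u <= A * v ->
  Cmod (RtoC (INR (S k) * a) * u * h) <= INR (S n) * beta * A * v.
Proof.
  intros Hk Ha HA Hv Hh Hu.
  rewrite !Cmod_mult, Cmod_R, Rabs_pos_eq by (apply Rmult_le_pos; [apply pos_INR|lra]).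
  assert (Hkn : INR (S k) <= INR (S n)) by (apply le_INR; lia).
  assert (Hk0 := pos_INR (S k)).
  assert (Hu0 := Cmod_ge_0 u). assert (Hh0 := Cmod_ge_0 h).
  assert (0 <= Cmod h * a) by (apply Rmult_le_pos; lra).
  replace (INR (S k) * a * Cmod u * Cmod h) with (INR (S k) * (Cmod h * a) * Cmod u) by ring.
  replace (INR (S n) * beta * A * v) with (INR (S n) * beta * (A * v)) by ring.
  repeat apply Rmult_le_compat; auto; apply Rmult_le_pos; auto.
Qed.

(** Along the segment each component has a derivative of order at most [2 * n + 1], which
    [dominated] bounds by a component already in the sum. *)
Lemma square_norm_segment1 F a b n A beta x y h : analytic F -> 0 < a -> 0 < b -> 0 <= A ->
  Cmod h * a <= beta ->
  (forall t : R, 0 <= t <= 1 ->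
    inD2 ((x + t * h)%C, y) /\ dominated F a b n A ((x + t * h)%C, y)) ->
  square_norm n (fun k1 k2 => wder F a b k1 k2 ((x + h)%C, y)) <=
    exp (INR (S n) ^ 2 * (2 * (INR (S n) * beta * A))) *
    square_norm n (fun k1 k2 => wder F a b k1 k2 (x, y)).
Proof.
  intros HF Ha Hb HA Hh H.
  assert (Hbeta : 0 <= beta)
    by (eapply Rle_trans; [|exact Hh]; apply Rmult_le_pos; [apply Cmod_ge_0|lra]).
  assert (Hg := square_norm_growth n (fun k1 k2 t => wder F a b k1 k2 ((x + t * h)%C, y))
    (fun k1 k2 t => RtoC (INR (S k1) * a) * wder F a b (S k1) k2 ((x + t * h)%C, y) * h)%C
    (INR (S n) * beta * A)).
  cbv beta in Hg; rewrite Cmult_1_l, Cmult_0_l, Cplus_0_r in Hg; apply Hg; clear Hg.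
  - repeat apply Rmult_le_pos; auto using pos_INR.
  - intros t k1 k2 Ht Hk1 Hk2; destruct (H t Ht) as [Hin Hdom]; split.
    + exact (C_path_deriv_comp _ (fun t => (x + t * h)%C) t _ _
        (wder_deriv1 F a b k1 k2 _ HF Ha Hb Hin) (C_path_deriv_line x h t)).
    + destruct (Hdom (S k1) k2 ltac:(lia)) as (m1 & m2 & Hm & Hd).
      exists m1, m2; split; [lia|split; [lia|]].
      apply directional_bound; auto using Cmod_ge_0.
Qed.

Lemma square_norm_segment2 F a b n A beta x y h : analytic F -> 0 < a -> 0 < b -> 0 <= A ->
  Cmod h * b <= beta ->
  (forall t : R, 0 <= t <= 1 ->
    inD2 (x, (y + t * h)%C) /\ dominated F a b n A (x, (y + t * h)%C)) ->
  square_norm n (fun k1 k2 => wder F a b k1 k2 (x, (y + h)%C)) <=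
    exp (INR (S n) ^ 2 * (2 * (INR (S n) * beta * A))) *
    square_norm n (fun k1 k2 => wder F a b k1 k2 (x, y)).
Proof.
  intros HF Ha Hb HA Hh H.
  assert (Hbeta : 0 <= beta)
    by (eapply Rle_trans; [|exact Hh]; apply Rmult_le_pos; [apply Cmod_ge_0|lra]).
  assert (Hg := square_norm_growth n (fun k1 k2 t => wder F a b k1 k2 (x, (y + t * h)%C))
    (fun k1 k2 t => RtoC (INR (S k2) * b) * wder F a b k1 (S k2) (x, (y + t * h)%C) * h)%C
    (INR (S n) * beta * A)).
  cbv beta in Hg; rewrite Cmult_1_l, Cmult_0_l, Cplus_0_r in Hg; apply Hg; clear Hg.
  - repeat apply Rmult_le_pos; auto using pos_INR.
  - intros t k1 k2 Ht Hk1 Hk2; destruct (H t Ht) as [Hin Hdom]; split.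
    + exact (C_path_deriv_comp _ (fun t => (y + t * h)%C) t _ _
        (wder_deriv2 F a b k1 k2 _ HF Ha Hb Hin) (C_path_deriv_line y h t)).
    + destruct (Hdom k1 (S k2) ltac:(lia)) as (m1 & m2 & Hm & Hd).
      exists m1, m2; split; [lia|split; [lia|]].
      apply directional_bound; auto using Cmod_ge_0.
Qed.

Lemma Cmod_segment (x w : C) (t r : R) : 0 <= t <= 1 -> Cmod (w - x) <= r ->
  Cmod (x + t * (w - x) - x) <= r.
Proof.
  intros Ht H; replace (x + t * (w - x) - x)%C with (t * (w - x))%C by ring.
  rewrite Cmod_mult, Cmod_R, Rabs_pos_eq by lra.
  assert (H0 := Cmod_ge_0 (w - x)); nra.
Qed.

(** The path runs from [(x0, y0)] to [(x, y0)] and then to [(x, y)]; both legs stay in the polydisc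
    and each costs one exponential factor. *)
Lemma square_norm_polydisc F a b n A beta r1 r2 z0 z : analytic F -> 0 < a -> 0 < b -> 0 <= A ->
  0 <= r1 -> 0 <= r2 -> r1 * a <= beta -> r2 * b <= beta ->
  (forall w, cpolydisc z0 r1 r2 w -> inD2 w /\ dominated F a b n A w) ->
  cpolydisc z0 r1 r2 z ->
  square_norm n (fun k1 k2 => wder F a b k1 k2 z) <=
    exp (INR (S n) ^ 2 * (2 * (INR (S n) * beta * A))) ^ 2 *
    square_norm n (fun k1 k2 => wder F a b k1 k2 z0).
Proof.
  intros HF Ha Hb HA Hr1 Hr2 Hr1a Hr2b H [Hz1 Hz2].
  destruct z0 as [x0 y0]; destruct z as [x y]; simpl fst in *; simpl snd in *.
  assert (E : forall u v : C, (u + (v - u))%C = v) by (intros; ring).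
  assert (E0 : forall w : C, (w - w)%C = 0) by (intros; ring).
  assert (H1 := square_norm_segment1 F a b n A beta x0 y0 (x - x0)%C HF Ha Hb HA).
  assert (H2 := square_norm_segment2 F a b n A beta x y0 (y - y0)%C HF Ha Hb HA).
  rewrite E in H1, H2.
  set (e := exp (INR (S n) ^ 2 * (2 * (INR (S n) * beta * A)))) in *.
  assert (He : 0 < e) by apply exp_pos.
  simpl; rewrite Rmult_1_r, Rmult_assoc.
  eapply Rle_trans; [apply H2|apply Rmult_le_compat_l; [lra|apply H1]].
  - eapply Rle_trans; [|exact Hr2b]; apply Rmult_le_compat_r; lra.
  - intros t Ht; apply H; split; simpl; auto using Cmod_segment.
  - eapply Rle_trans; [|exact Hr1a]; apply Rmult_le_compat_r; lra.
  - intros t Ht; apply H; split; simpl; auto using Cmod_segment.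
    rewrite E0, Cmod_0; lra.
Qed.

(** * From bounded index to polydisc bounds *)

Lemma dominated_of_index F l1 l2 n c z0 z : 1 <= c ->
  0 < l1 z0 -> 0 < l2 z0 -> 0 < l1 z -> 0 < l2 z ->
  l1 z0 <= c * l1 z -> l2 z0 <= c * l2 z -> l1 z <= c * l1 z0 -> l2 z <= c * l2 z0 ->
  (forall p1 p2, exists k1 k2, (k1 + k2 <= n)%nat /\
     nder F l1 l2 p1 p2 z <= nder F l1 l2 k1 k2 z) ->
  dominated F (l1 z0) (l2 z0) n (c ^ (3 * n + 1)) z.
Proof.
  intros Hc Ha Hb Ha' Hb' H1 H2 H3 H4 H p1 p2 Hp.
  destruct (H p1 p2) as (m1 & m2 & Hm & Hle).
  exists m1, m2; split; auto.
  assert (En : forall k1 k2, nder F l1 l2 k1 k2 z = Cmod (wder F (l1 z) (l2 z) k1 k2 z))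
    by (intros; now rewrite Cmod_wder).
  rewrite !En in Hle.
  assert (Hpow : forall k, 0 <= c ^ k) by (intros; apply pow_le; lra).
  (* The weight is changed to the one at [z], where the index hypothesis holds, and then back; the
     exponents add up to at most [(2n + 1) + n]. *)
  eapply Rle_trans; [apply (wder_change_weight F _ _ (l1 z) (l2 z) c); auto; lra|].
  apply Rle_trans with (c ^ (p1 + p2) * (c ^ (m1 + m2) * Cmod (wder F (l1 z0) (l2 z0) m1 m2 z))).
  - apply Rmult_le_compat_l; auto.
    eapply Rle_trans; [exact Hle|apply wder_change_weight; auto; lra].
  - rewrite <- Rmult_assoc, <- pow_add.
    apply Rmult_le_compat_r; [apply Cmod_ge_0|]. apply Rle_pow; auto; lia.
Qed.

Lemma L_comparable beta l1 l2 r1 r2 : 1 < beta -> L_admissible beta l1 l2 -> Q2 beta l1 l2 ->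
  0 < r1 <= beta -> 0 < r2 <= beta ->
  exists c, 1 <= c /\ forall z0 z, inD2 z0 -> inD2 z ->
    cpolydisc z0 (r1 / l1 z0) (r2 / l2 z0) z ->
    l1 z0 <= c * l1 z /\ l2 z0 <= c * l2 z /\ l1 z <= c * l1 z0 /\ l2 z <= c * l2 z0.
Proof.
  intros Hb (_ & _ & HL) HQ Hr1 Hr2.
  destruct (HQ r1 r2 ltac:(lra) ltac:(lra) l1 (or_introl eq_refl)) as (c11 & c12 & Hc1 & H1).
  destruct (HQ r1 r2 ltac:(lra) ltac:(lra) l2 (or_intror eq_refl)) as (c21 & c22 & Hc2 & H2).
  assert (Hi1 := Rinv_0_lt_compat _ Hc1); assert (Hi2 := Rinv_0_lt_compat _ Hc2).
  assert (Ha1 := Rabs_pos c12); assert (Ha2 := Rabs_pos c22).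
  assert (Hl1 := Rle_abs c12); assert (Hl2 := Rle_abs c22).
  (* [c] exceeds both upper bounds and the reciprocals of both lower bounds; the absolute values
     make [1 <= c] immediate. *)
  set (c := 1 + Rabs c12 + Rabs c22 + / c11 + / c21).
  exists c; split; [unfold c; lra|].
  intros z0 z Hz0 Hz Hp.
  specialize (H1 z0 Hz0 z Hz Hp); specialize (H2 z0 Hz0 z Hz Hp).
  assert (Hpos : forall w, inD2 w -> 0 < l1 w /\ 0 < l2 w).
  { intros w Hw; destruct (HL w Hw) as [HLa HLb]; destruct Hw as [Hw1 Hw2].
    split; [eapply (proj1 (L_radius_lt beta beta _ _ ltac:(lra) ltac:(lra) Hw1 HLa))
           |eapply (proj1 (L_radius_lt beta beta _ _ ltac:(lra) ltac:(lra) Hw2 HLb))]. }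
  assert (Hcmp : forall u v d1 d2, 0 < u -> 0 < v -> 0 < d1 -> / d1 <= c -> d2 <= c ->
    d1 <= v / u <= d2 -> u <= c * v /\ v <= c * u).
  { intros u v d1 d2 Hu Hv Hd Hd1 Hd2 [Hle1 Hle2].
    apply (Rmult_le_compat_r u) in Hle1; [|lra]; apply (Rmult_le_compat_r u) in Hle2; [|lra].
    replace (v / u * u) with v in * by (field; lra).
    split; [|nra].
    apply Rle_trans with (/ d1 * v); [|apply Rmult_le_compat_r; lra].
    apply Rmult_le_reg_l with d1; auto.
    rewrite <- Rmult_assoc, Rinv_r by lra; lra. }
  destruct (Hpos z0 Hz0); destruct (Hpos z Hz).
  destruct (Hcmp (l1 z0) (l1 z) c11 c12); auto; try (unfold c; lra).
  destruct (Hcmp (l2 z0) (l2 z) c21 c22); auto; unfold c; lra.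
Qed.

Lemma polydisc_bounds_of_bounded_index beta l1 l2 F r1 r2 :
  1 < beta -> L_admissible beta l1 l2 -> Q2 beta l1 l2 -> analytic F ->
  bounded_L_index_joint F l1 l2 -> 0 < r1 <= beta -> 0 < r2 <= beta ->
  exists (n0 : nat) (p : R), 1 <= p /\
    forall z0, inD2 z0 -> exists k1 k2 : nat, (k1 + k2 <= n0)%nat /\
      forall z, inD2 z -> cpolydisc z0 (r1 / l1 z0) (r2 / l2 z0) z ->
        Cmod (Fder F k1 k2 z) <= p * Cmod (Fder F k1 k2 z0).
Proof.
  intros Hb HL HQ HF [n Hn] Hr1 Hr2.
  destruct (L_comparable beta l1 l2 r1 r2 Hb HL HQ Hr1 Hr2) as (c & Hc & Hcmp).
  assert (HA : 0 <= c ^ (3 * n + 1)) by (apply pow_le; lra).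
  set (A := c ^ (3 * n + 1)) in *.
  set (e := exp (INR (S n) ^ 2 * (2 * (INR (S n) * beta * A)))).
  (* One factor [e] per leg of the path, and [(n + 1)^2] for the number of terms in the square norm
     at [z0]. *)
  set (P := e ^ 2 * INR (S n) ^ 2).
  assert (HSn : 1 <= INR (S n)) by (rewrite S_INR; assert (H := pos_INR n); lra).
  assert (He : 1 <= e).
  { unfold e; eapply Rle_trans; [|apply exp_ineq1_le].
    assert (0 <= INR (S n) ^ 2 * (2 * (INR (S n) * beta * A))); [|lra].
    repeat apply Rmult_le_pos; try apply pow_le; lra. }
  assert (HP : 1 <= P).
  { unfold P; rewrite <- Rpow_mult_distr; apply pow_R1_Rle; nra. }
  (* The indices are maximized over the square [k1, k2 <= n], so their sum may reach [2 * n]. *)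
  exists (2 * n)%nat, P; split; auto.
  intros z0 Hz0.
  assert (Hrad : forall w, inD2 w ->
    (0 < l1 w /\ 0 < r1 / l1 w /\ Cmod (fst w) + r1 / l1 w < 1) /\
    (0 < l2 w /\ 0 < r2 / l2 w /\ Cmod (snd w) + r2 / l2 w < 1)).
  { intros w Hw; destruct HL as (_ & _ & HL); destruct (HL w Hw) as [HLa HLb].
    destruct Hw as [Hw1 Hw2]; split;
      [apply L_radius_lt with beta|apply L_radius_lt with beta]; auto; lra. }
  destruct (Hrad z0 Hz0) as [(Ha & Hra & Hda) (Hb' & Hrb & Hdb)].
  (* The pair depends only on the centre [z0] and serves for all [z] in the polydisc. *)
  destruct (exists_max_square (fun k1 k2 => Cmod (wder F (l1 z0) (l2 z0) k1 k2 z0)) n)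
    as (k1 & k2 & Hk1 & Hk2 & Hmax).
  exists k1, k2; split; [lia|]; intros z Hz Hp.
  assert (Hdom : forall w, cpolydisc z0 (r1 / l1 z0) (r2 / l2 z0) w ->
    inD2 w /\ dominated F (l1 z0) (l2 z0) n A w).
  { intros w Hw.
    assert (Hin : inD2 w).
    { assert (Htri : forall u v : C, Cmod v <= Cmod u + Cmod (v - u)).
      { intros u v; assert (Ht := Cmod_triangle u (v - u)).
        now replace (u + (v - u))%C with v in Ht by ring. }
      destruct Hw as [Hw1 Hw2].
      assert (Ht1 := Htri (fst z0) (fst w)); assert (Ht2 := Htri (snd z0) (snd w)).
      split; lra. }
    split; auto.
    destruct (Hrad w Hin) as [(Hwa & _) (Hwb & _)].
    destruct (Hcmp z0 w Hz0 Hin Hw) as (? & ? & ? & ?).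
    apply dominated_of_index; auto. }
  assert (Hg := square_norm_polydisc F (l1 z0) (l2 z0) n A beta (r1 / l1 z0) (r2 / l2 z0) z0 z
    HF Ha Hb' HA (Rlt_le _ _ Hra) (Rlt_le _ _ Hrb)).
  fold e in Hg.
  assert (Hg' := Hg ltac:(unfold Rdiv; rewrite Rmult_assoc, Rinv_l; lra)
    ltac:(unfold Rdiv; rewrite Rmult_assoc, Rinv_l; lra) Hdom Hp).
  assert (Hk := square_norm_ge_term n (fun k1 k2 => wder F (l1 z0) (l2 z0) k1 k2 z) k1 k2 Hk1 Hk2).
  set (g := Cmod (wder F (l1 z0) (l2 z0) k1 k2 z0)) in *.
  assert (Hg0 : 0 <= g) by apply Cmod_ge_0.
  assert (Hs : square_norm n (fun k1 k2 => wder F (l1 z0) (l2 z0) k1 k2 z0) <= INR (S n) ^ 2 * g ^ 2).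
  { apply double_sum_le_const; intros i j Hi Hj; apply pow_incr; split; [apply Cmod_ge_0|].
    now apply (Hmax i j). }
  assert (Hfin : Cmod (wder F (l1 z0) (l2 z0) k1 k2 z) <= P * g).
  { apply Rsqr_incr_0_var; [|apply Rmult_le_pos; lra].
    rewrite !Rsqr_pow2.
    (* The estimate concerns squares; as [P >= 1], [P] is at most [P^2] and no square root is
       required. *)
    apply Rle_trans with (P * g ^ 2).
    - unfold P; eapply Rle_trans; [exact Hk|]; eapply Rle_trans; [exact Hg'|].
      rewrite Rmult_assoc; apply Rmult_le_compat_l; auto; apply pow2_ge_0.
    - rewrite Rpow_mult_distr; apply Rmult_le_compat_r; [apply pow2_ge_0|nra]. }
  (* The same frozen weight divides both sides and cancels. *)
  unfold g in Hfin; rewrite !Cmod_wder in Hfin by auto.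
  assert (Hw := weight_pos (l1 z0) (l2 z0) k1 k2 Ha Hb').
  apply (Rmult_le_compat_r (weight (l1 z0) (l2 z0) k1 k2)) in Hfin; [|lra].
  replace (Cmod (Fder F k1 k2 z) / weight (l1 z0) (l2 z0) k1 k2 * weight (l1 z0) (l2 z0) k1 k2)
    with (Cmod (Fder F k1 k2 z)) in Hfin by (field; lra).
  replace (P * (Cmod (Fder F k1 k2 z0) / weight (l1 z0) (l2 z0) k1 k2) * weight (l1 z0) (l2 z0) k1 k2)
    with (P * Cmod (Fder F k1 k2 z0)) in Hfin by (field; lra).
  exact Hfin.
Qed.

Theorem theorem2 (beta : R) (l1 l2 : C * C -> R) (F : C * C -> C) :
  1 < beta -> L_admissible beta l1 l2 -> Q2 beta l1 l2 -> analytic_D2 F ->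
  (* (i) *)
  (bounded_L_index_joint F l1 l2 ->
   forall r1 r2 : R, 0 < r1 <= beta -> 0 < r2 <= beta ->
   exists (n0 : nat) (p : R), 1 <= p /\
     forall z0, inD2 z0 ->
       exists k1 k2 : nat, (k1 + k2 <= n0)%nat /\
         forall z, inD2 z -> cpolydisc z0 (r1 / l1 z0) (r2 / l2 z0) z ->
           Cmod (Fder F k1 k2 z) <= p * Cmod (Fder F k1 k2 z0)) /\
  (* (ii) *)
  ((forall r1 r2 : R, 0 < r1 <= beta -> 0 < r2 <= beta ->
    exists (n0 : nat) (p : R), 1 <= p /\
      forall z0, inD2 z0 ->
        exists k1 k2 : nat, (k1 <= n0)%nat /\ (k2 <= n0)%nat /\
          (forall z, inD2 z -> cpolydisc z0 (r1 / l1 z0) (r2 / l2 z0) z ->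
             Cmod (Fder F k1 0 z) <= p * Cmod (Fder F k1 0 z0)) /\
          (forall z, inD2 z -> cpolydisc z0 (r1 / l1 z0) (r2 / l2 z0) z ->
             Cmod (Fder F 0 k2 z) <= p * Cmod (Fder F 0 k2 z0)))
   -> bounded_L_index_joint F l1 l2).
Proof.
  intros Hb HL HQ HF; apply analytic_D2_analytic in HF; split.
  - intros Hn r1 r2 Hr1 Hr2; now apply polydisc_bounds_of_bounded_index with beta.
  - intros H; destruct (H beta beta ltac:(lra) ltac:(lra)) as (n0 & p & Hp & H').
    now apply bounded_index_of_polydisc_bounds with beta n0 p.
Qed.
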